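(* Let $r>0$, let $\psi\in C^2([-r,0],\mathbb{R})$ satisfy $\psi(t)\ge 0$ for all $t\in[-r,0]$, $\psi'(0)\ge 0$ and $\psi''(0)\ge 0$, and let $F:[0,1]\times C^2([-r,0],\mathbb{R})\to[0,\infty)$ satisfy the Carathéodory-type conditions: (i) for each $\phi$, the map $t\mapsto F(t,\phi)$ is measurable; (ii) for a.e. $t$, the map $\phi\mapsto F(t,\phi)$ is continuous; (iii) for each $R>0$ there exists $\varphi_R\in L^\infty[0,1]$ such that $F(t,\phi)\le\varphi_R(t)$ for all $\phi\in C^2([-r,0],\mathbb{R})$ with $\|\phi\|_{[-r,0],2}\le R$ and a.e. $t\in[0,1]$. Let $\widehat\psi$, $K_{\widehat\psi,\rho}$, $\overline{K}_{\widehat\psi,\rho}$, $\partial K_{\widehat\psi,\rho}$, $k$ and $\gamma_3$ be as defined in the context. Let $\rho\in(0,+\infty)$ and assume that the following conditions hold. (a) There exists $\underline{\delta}_\rho\in C([0,1],[0,\infty))$ such that $$F(t,\phi)\ge\underline{\delta}_\rho(t)\quad\text{for every }(t,\phi)\in[0,1]\times C^2([-r,0],\mathbb{R})\text{ with }\|\phi\|_{[-r,0],2}\le\rho+\|\widehat\psi\|_{[-r,1],2}.$$ (b) $B:\overline{K}_{\widehat\psi,\rho}\to[0,\infty)$ is continuous and bounded, and $\underline{\eta}_\rho\in[0,+\infty)$ is such that $B[u]\ge\underline{\eta}_\rho$ for every $u\in\partial K_{\widehat\psi,\rho}$. (c) The inequality $$\sup_{t\in[0,1]}\Bigl\{\gamma_3(t)\,\underline{\eta}_\rho+\int_0^1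 k(t,s)\,\underline{\delta}_\rho(s)\,ds\Bigr\}>0$$ holds. Then there exist $\lambda_\rho\in(0,+\infty)$ and $u_\rho\in\partial K_{\widehat\psi,\rho}$ such that $(\lambda,u)=(\lambda_\rho,u_\rho)$ satisfies the functional boundary value problem $$\begin{cases}u^{(4)}(t)+\lambda F(t,u_t)=0, & t\in[0,1],\\ u(t)=\psi(t), & t\in[-r,0],\\ u'''(1)=\lambda B[u].\end{cases}$$
   Context: For a compact interval $I\subset\mathbb{R}$, $C^2(I,\mathbb{R})$ is the Banach space of twice continuously differentiable functions on $I$ with norm $\|u\|_{I,2}=\max\{\|u\|_{I,\infty},\|u'\|_{I,\infty},\|u''\|_{I,\infty}\}$, where $\|u\|_{I,\infty}=\sup_{t\in I}|u(t)|$. For $u:[-r,1]\to\mathbb{R}$ and $t\in[0,1]$, $u_t:[-r,0]\to\mathbb{R}$ denotes the function $u_t(\theta)=u(t+\theta)$. The extension $\widehat\psi\in C^2([-r,1],\mathbb{R})$ of $\psi$ is $$\widehat\psi(t)=\begin{cases}\psi(t), & -r\le t\le 0,\\ \psi(0)+t\,\psi'(0)+\tfrac12 t^2\,\psi''(0), & 0<t\le 1.\end{cases}$$ The functions $\gamma_3$ and $k$ are $$\gamma_3(t)=\tfrac16 t^3,\qquad k(t,s)=\frac16\begin{cases}t^3, & 0\le t\le s\le 1,\\ s(3t^2-3ts+s^2), & 0\le s\le t\le 1.\end{cases}$$ Let $$K_0=\{u\in C^2([-r,1],\mathbb{R}): u(t)\ge 0\ \forall t\in[-r,1],\ \text{and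 } u(t)=u'(t)=u''(t)=0\ \forall t\in[-r,0]\}.$$ Put $K_{0,\rho}=\{u\in K_0:\|u\|_{[0,1],2}<\rho\}$, $K_{\widehat\psi}=\widehat\psi+K_0$ and $K_{\widehat\psi,\rho}=\widehat\psi+K_{0,\rho}$. The closure $\overline{K}_{\widehat\psi,\rho}$ and boundary $\partial K_{\widehat\psi,\rho}$ are taken relative to $K_{\widehat\psi}$, with the topology of $C^2([-r,1],\mathbb{R})$; thus $\partial K_{\widehat\psi,\rho}=\{\widehat\psi+v: v\in K_0,\ \|v\|_{[0,1],2}=\rho\}$ and $\overline{K}_{\widehat\psi,\rho}=\{\widehat\psi+v: v\in K_0,\ \|v\|_{[0,1],2}\le\rho\}$. Solutions are understood in the Carathéodory sense: $u\in C^2([-r,1],\mathbb{R})$, the restriction $u|_{[0,1]}$ is of class $C^3$ with $u'''$ absolutely continuous on $[0,1]$ (one-sided derivatives at the endpoints), the differential equation holds for a.e. $t\in[0,1]$, and the initial condition and the condition at $t=1$ hold as written. *)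

(* Defs.v *)
From HB Require Import structures.
From mathcomp Require Import all_boot all_order all_algebra.
From mathcomp Require Import all_classical all_reals all_analysis.
From mathcomp Require Import ring lra.

Set Implicit Arguments.
Unset Strict Implicit.
Unset Printing Implicit Defensive.
Import Order.TTheory GRing.Theory Num.Theory.
Import numFieldNormedType.Exports.

Local Open Scope classical_set_scope.
Local Open Scope ring_scope.

Definition quot {R : realType} (f : R -> R) (t s : R) : R :=
  (f s - f t) / (s - t).

(* Differentiability at [t] of the restriction of [f] to [[a, b]]: the
   difference quotients converge as [s] tends to [t] inside [[a, b]], so the
   derivative is one-sided at the endpoints. *)
Definition derivable_itv {R : realType} (a b : R) (f : R -> R) (t : R) : Prop :=
  cvg (quot f t s @[s --> within `[a, b] t^']).

(* The derivative of the restriction of [f] to [[a, b]], extended by 0; it is 0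
   on a degenerate interval, where the limit is meaningless. *)
HB.lock Definition deriv_itv {R : realType} (a b : R) (f : R -> R) : R -> R := fun t =>
  if (a < b) && (t \in `[a, b]) then
    lim (quot f t s @[s --> within `[a, b] t^'])
  else 0.

Definition derivn_itv {R : realType} (a b : R) (n : nat) (f : R -> R) :
  R -> R := iter n (deriv_itv a b) f.

Definition is_Cn {R : realType} (n : nat) (a b : R) (f : R -> R) : Prop :=
  (forall i, (i < n)%N -> forall t, t \in `[a, b] ->
     derivable_itv a b (derivn_itv a b i f) t) /\
  {within `[a, b], continuous (derivn_itv a b n f)}.

Definition supnorm {R : realType} (a b : R) (f : R -> R) : R :=
  sup [set `|f t| | t in `[a, b]].

Definition normC2 {R : realType} (a b : R) (f : R -> R) : R :=
  Num.max (supnorm a b f)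
    (Num.max (supnorm a b (derivn_itv a b 1 f))
             (supnorm a b (derivn_itv a b 2 f))).

Section derivatives.
Context {R : realType}.
Implicit Types (a b c d t s l e : R) (f g h : R -> R).

Definition has_deriv_itv a b f t l : Prop :=
  forall e, 0 < e -> exists2 d, 0 < d & forall s, s \in `[a, b] ->
    `|s - t| < d -> `|f s - f t - l * (s - t)| <= e * `|s - t|.

Lemma has_deriv_itvP a b f t l :
  quot f t s @[s --> within `[a, b] t^'] --> l <-> has_deriv_itv a b f t l.
Proof.
split=> [/cvgrPdist_le fl e e0|fl].
  have := fl _ e0; rewrite near_withinE => -[d /= d0 H].
  exists d => // s sab sd; have [->|st] := eqVneq s t.
    by rewrite !subrr mulr0 subrr normr0 mulr0.
  have st0 : s - t != 0 by rewrite subr_eq0.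
  have := H s; rewrite /= distrC => /(_ sd st sab).
  rewrite -(ler_pM2r (_ : 0 < `|s - t|)) ?normr_gt0// -normrM.
  by rewrite mulrBl /quot mulfVK// distrC.
apply/cvgrPdist_le => e e0; rewrite near_withinE.
have [d d0 H] := fl _ e0; exists d => //= s sd st sab.
have st0 : s - t != 0 by rewrite subr_eq0.
rewrite -(ler_pM2r (_ : 0 < `|s - t|)) ?normr_gt0// -normrM.
rewrite mulrBl /quot mulfVK// distrC; apply: H => //.
by rewrite distrC.
Qed.

Lemma within_dnbhs_proper a b t : a < b -> t \in `[a, b] ->
  ProperFilter (within `[a, b] t^').
Proof.
move=> ab tab; apply: Build_ProperFilter_ex => P.
rewrite /within /= => -[d /= d0 H].
move: tab; rewrite in_itv/= => /andP[at_ tb].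
have [tb'|bt] := ltP t b.
  pose s := t + Num.min (d / 2) (b - t).
  have m0 : 0 < Num.min (d / 2) (b - t) by rewrite lt_min divr_gt0//= subr_gt0.
  exists s; apply: H => //=.
  - rewrite /s opprD addNKr normrN gtr0_norm// gt_min; apply/orP; left; lra.
  - by rewrite /s -subr_eq0 addrC addKr gt_eqF.
  - rewrite in_itv/= /s; apply/andP; split; first by lra.
    by rewrite -lerBrDl ge_min lexx orbT.
pose s := t - Num.min (d / 2) (b - a).
have m0 : 0 < Num.min (d / 2) (b - a) by rewrite lt_min divr_gt0//= subr_gt0.
have mba : Num.min (d / 2) (b - a) <= b - a by rewrite ge_min lexx orbT.
exists s; apply: H => //=.
- by rewrite /s opprB addrC subrK gtr0_norm// gt_min; apply/orP; left; lra.
- by rewrite /s -subr_eq0 addrC addKr oppr_eq0 gt_eqF.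
- by rewrite in_itv/= /s; apply/andP; split; lra.
Qed.

Lemma has_deriv_itvE a b f t l : a < b -> t \in `[a, b] ->
  has_deriv_itv a b f t l -> deriv_itv a b f t = l.
Proof.
move=> ab tab /has_deriv_itvP fl; rewrite deriv_itv.unlock ab tab /=.
by have ? := within_dnbhs_proper ab tab; exact: cvg_lim.
Qed.

Lemma derivable_itvP a b f t : a < b -> t \in `[a, b] ->
  derivable_itv a b f t <-> has_deriv_itv a b f t (deriv_itv a b f t).
Proof.
move=> ab tab; rewrite -has_deriv_itvP deriv_itv.unlock ab tab /=.
by split=> // H; apply/cvg_ex; eexists; exact: H.
Qed.

Lemma has_deriv_itv_eq a b f g t l : t \in `[a, b] ->
  {in `[a, b], f =1 g} -> has_deriv_itv a b f t l -> has_deriv_itv a b g t l.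
Proof.
move=> tab fg H e /H[d d0 {}H]; exists d => // s sab.
by rewrite -!fg//; exact: H.
Qed.

Lemma within_itv_continuousP a b f : {within `[a, b], continuous f} <->
  forall t, t \in `[a, b] -> forall e, 0 < e ->
    exists2 d, 0 < d & forall s, s \in `[a, b] -> `|s - t| < d ->
      `|f s - f t| <= e.
Proof.
split.
  move/subspace_continuousP => H t tab e e0.
  have /cvgrPdist_le/(_ _ e0) := H _ tab.
  rewrite near_withinE => -[d /= d0 {}H]; exists d => // s sab sd.
  by rewrite distrC; apply: H => //=; rewrite distrC.
move=> H; apply/subspace_continuousP => t tab; apply/cvgrPdist_le => e e0.
have [d d0 {}H] := H _ tab _ e0; rewrite near_withinE.
by exists d => //= s sd sab; rewrite distrC; apply: H => //; rewrite distrC.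
Qed.

Lemma within_itv_continuous_eq a b f g : {in `[a, b], f =1 g} ->
  {within `[a, b], continuous f} -> {within `[a, b], continuous g}.
Proof.
move=> fg /within_itv_continuousP H; apply/within_itv_continuousP => t tab e.
move=> /(H _ tab)[d d0 {}H]; exists d => // s sab.
by rewrite -!fg//; exact: H.
Qed.

Lemma has_deriv_itv_continuous a b f g :
  (forall t, t \in `[a, b] -> has_deriv_itv a b f t (g t)) ->
  {within `[a, b], continuous f}.
Proof.
move=> H; apply/within_itv_continuousP => t tab e e0.
have [d d0 {}H] := H _ tab 1 ltr01.
have k0 : 0 < `|g t| + 1 by rewrite ltr_pwDr.
exists (Num.min d (e / (`|g t| + 1))).
  by rewrite lt_min d0 divr_gt0.
move=> s sab; rewrite lt_min => /andP[/(H _ sab)].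
rewrite mul1r => {}H; rewrite ltr_pdivlMr// => st.
have -> : f s - f t = (f s - f t - g t * (s - t)) + g t * (s - t) by ring.
apply: (le_trans (ler_normD _ _)); rewrite normrM.
by move: st; lra.
Qed.

Lemma is_C2P a b f : a < b -> is_Cn 2 a b f <-> exists g h,
  [/\ forall t, t \in `[a, b] -> has_deriv_itv a b f t (g t),
      forall t, t \in `[a, b] -> has_deriv_itv a b g t (h t) &
      {within `[a, b], continuous h}].
Proof.
move=> ab; split=> [[df cf]|[g [h [fg gh ch]]]].
  exists (deriv_itv a b f), (deriv_itv a b (deriv_itv a b f)).
  split=> // t tab; apply/derivable_itvP => //.
    exact: (df 0%N).
  exact: (df 1%N).
have fE : {in `[a, b], g =1 deriv_itv a b f}.
  by move=> t tab; rewrite (has_deriv_itvE ab tab (fg t tab)).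
have gE t : t \in `[a, b] -> has_deriv_itv a b (deriv_itv a b f) t (h t).
  by move=> tab; apply: has_deriv_itv_eq (gh t tab).
split.
  case=> [|[|//]] _ t tab; apply/derivable_itvP => //=.
    by rewrite -fE//; exact: fg.
  by rewrite (has_deriv_itvE ab tab (gE t tab)); exact: gE.
apply: within_itv_continuous_eq ch => t tab.
by rewrite /derivn_itv /= (has_deriv_itvE ab tab (gE t tab)).
Qed.

Lemma is_C2_derivE a b f g h : a < b ->
  (forall t, t \in `[a, b] -> has_deriv_itv a b f t (g t)) ->
  (forall t, t \in `[a, b] -> has_deriv_itv a b g t (h t)) ->
  forall t, t \in `[a, b] ->
    derivn_itv a b 1 f t = g t /\ derivn_itv a b 2 f t = h t.
Proof.
move=> ab fg gh t tab.
have fE : {in `[a, b], g =1 deriv_itv a b f}.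
  by move=> u uab; rewrite (has_deriv_itvE ab uab (fg u uab)).
split; first by rewrite fE.
by apply: has_deriv_itvE => //; apply: has_deriv_itv_eq (gh t tab).
Qed.

Lemma deriv_itv_lin a b k f g :
  (forall t, t \in `[a, b] -> derivable_itv a b f t) ->
  (forall t, t \in `[a, b] -> derivable_itv a b g t) ->
  (forall t, t \in `[a, b] -> derivable_itv a b (k *: f + g) t) /\
  deriv_itv a b (k *: f + g) = k *: deriv_itv a b f + deriv_itv a b g.
Proof.
move=> df dg.
have qE t : quot (k *: f + g) t = k *: quot f t + quot g t.
  apply/funext => s; rewrite /quot !fctE /= -[k *: f s]/(k * f s).
  rewrite -[k *: f t]/(k * f t) -[_ *: (_ / _)]/(k * ((f s - f t) / (s - t))).
  by ring.
split=> [t tab|].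
  rewrite /derivable_itv qE; apply: is_cvgD; last exact: dg.
  by apply: is_cvgZr; exact: df.
apply/funext => t; rewrite !fctE deriv_itv.unlock qE.
case: ifPn => [/andP[ab tab]|_]; last by rewrite scaler0 addr0.
have ? := within_dnbhs_proper ab tab.
rewrite limD; [|by apply: is_cvgZr; exact: df|exact: dg].
by rewrite limZr//; exact: df.
Qed.

Lemma deriv_itv0 a b : deriv_itv a b 0 = 0 /\
  forall t, t \in `[a, b] -> derivable_itv a b 0 t.
Proof.
have q0 t : quot (0 : R -> R) t = cst 0.
  by apply/funext => s; rewrite /quot !fctE subrr mul0r.
split; last by move=> t _; rewrite /derivable_itv q0; exact: is_cvg_cst.
apply/funext => t; rewrite deriv_itv.unlock q0; case: ifPn => // /andP[ab tab].
by have ? := within_dnbhs_proper ab tab; rewrite lim_cst.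
Qed.

Lemma is_C2_lin a b k f g : is_Cn 2 a b f -> is_Cn 2 a b g ->
  is_Cn 2 a b (k *: f + g) /\
  forall i, (i <= 2)%N ->
    derivn_itv a b i (k *: f + g) =
    k *: derivn_itv a b i f + derivn_itv a b i g.
Proof.
move=> [df cf] [dg cg].
have [d0 E1] := deriv_itv_lin k (df 0%N isT) (dg 0%N isT).
have [d1 E2] := deriv_itv_lin k (df 1%N isT) (dg 1%N isT).
have E i : (i <= 2)%N -> derivn_itv a b i (k *: f + g) =
    k *: derivn_itv a b i f + derivn_itv a b i g.
  by case: i => [|[|[|//]]] _; [|exact: E1|by rewrite [LHS](congr1 (deriv_itv a b) E1) E2].
split=> //; split=> [i i2|].
  by rewrite E 1?ltnW//; case: i i2 => [|[|//]].
rewrite E//; move=> x; apply: cvgD; last exact: cg.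
by apply: cvgZr; exact: cf.
Qed.

Lemma is_C2_0 a b : is_Cn 2 a b 0 /\
  forall i, derivn_itv a b i 0 = 0.
Proof.
have E i : derivn_itv a b i 0 = 0.
  by elim: i => // i IH; rewrite /derivn_itv /= [iter _ _ _]IH (deriv_itv0 a b).1.
split=> //; split=> [i _|]; first by rewrite E; exact: (deriv_itv0 a b).2.
by rewrite E => x; exact: cvg_cst.
Qed.

Lemma is_C2_continuous a b f : is_Cn 2 a b f -> forall i, (i <= 2)%N ->
  {within `[a, b], continuous (derivn_itv a b i f)}.
Proof.
have [ab|ba|->] := ltgtP a b; last 2 first.
- by move=> _ i _; rewrite set_itv_ge ?bnd_simp -?ltNge//;
    exact: continuous_subspace0.
- by move=> _ i _; rewrite set_itv1; exact: continuous_subspace1.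
move=> [df cf]; have H i : (i < 2)%N ->
    {within `[a, b], continuous (derivn_itv a b i f)}.
  move=> i2; apply: (@has_deriv_itv_continuous _ _ _ (derivn_itv a b i.+1 f)).
  by move=> t tab; apply/derivable_itvP => //; exact: df.
by case=> [|[|[|//]]] _; [exact: (H 0%N)|exact: (H 1%N)|].
Qed.

End derivatives.

Section norms.
Context {R : realType}.
Implicit Types (a b t M : R) (f g : R -> R).

Lemma supnorm_ge0 a b f : 0 <= supnorm a b f.
Proof.
rewrite /supnorm; set S := [set _ | _ in _].
have [hS|nS] := pselect (has_sup S); last by rewrite sup_out.
have [[_ [t tab _]] _] := hS.
by apply: (@le_trans _ _ `|f t|) => //; apply: sup_upper_bound => //; exists t.
Qed.

Lemma supnorm_le a b f M : 0 <= M ->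
  (forall t, t \in `[a, b] -> `|f t| <= M) -> supnorm a b f <= M.
Proof.
move=> M0 fM; rewrite /supnorm.
have [->|/set0P S0] := eqVneq [set `|f t| | t in `[a, b]] set0.
  by rewrite sup0.
by apply: ge_sup => // _ [t tab <-]; exact: fM.
Qed.

Lemma supnorm_ub a b f t : {within `[a, b], continuous f} -> t \in `[a, b] ->
  `|f t| <= supnorm a b f.
Proof.
move=> cf tab.
have ab : a <= b by move: tab; rewrite in_itv/= => /andP[]; exact: le_trans.
have cnf : {within `[a, b], continuous (fun t => `|f t|)}.
  apply/within_itv_continuousP => u uab e e0.
  move/within_itv_continuousP : cf => /(_ _ uab _ e0)[d d0 H].
  exists d => // s sab sd; apply: le_trans (H _ sab sd).
  exact: ler_dist_dist.
have [c cab H] := EVT_max ab cnf.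
apply: sup_upper_bound; last by exists t.
split; first by exists `|f t|, t.
by exists `|f c| => _ [s sab <-]; exact: H.
Qed.

Lemma normC2_ge0 a b f : 0 <= normC2 a b f.
Proof. by rewrite /normC2 le_max supnorm_ge0. Qed.

Lemma normC2_leP a b f M : is_Cn 2 a b f -> 0 <= M ->
  normC2 a b f <= M <-> forall i, (i <= 2)%N -> forall t, t \in `[a, b] ->
    `|derivn_itv a b i f t| <= M.
Proof.
move=> cf M0; rewrite /normC2 !ge_max; split=> [/and3P[f0 f1 f2] i i2 t tab|H].
  apply: le_trans (supnorm_ub (is_C2_continuous cf i2) tab) _.
  by case: i i2 => [|[|[|//]]].
by apply/and3P; split; apply: supnorm_le => // t tab;
  [exact: (H 0%N)|exact: (H 1%N)|exact: (H 2%N)].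
Qed.

Lemma normC2_ub a b f i t : is_Cn 2 a b f -> (i <= 2)%N -> t \in `[a, b] ->
  `|derivn_itv a b i f t| <= normC2 a b f.
Proof.
move=> cf i2 tab.
exact: (iffLR (normC2_leP cf (normC2_ge0 a b f)) (lexx _)).
Qed.

End norms.

(* [C^2([a, b])], each class being represented by the function on the line
   that vanishes outside [[a, b]], so that equality is equality on [[a, b]]. *)
Definition C2_pred {R : realType} (a b : R) : {pred R -> R} :=
  mem [set f | is_Cn 2 a b f /\ forall t, t \notin `[a, b] -> f t = 0].

Record C2 {R : realType} (a b : R) := MkC2 {
  C2_fun :> R -> R;
  C2_funP : C2_fun \in C2_pred a b }.

HB.instance Definition _ (R : realType) (a b : R) :=
  [isSub for @C2_fun R a b].
HB.instance Definition _ (R : realType) (a b : R) :=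
  [Choice of C2 a b by <:].

Lemma C2_submod_closed {R : realType} (a b : R) : submod_closed (C2_pred a b).
Proof.
split; first by rewrite inE; split=> //; exact: (is_C2_0 a b).1.
move=> k f g; rewrite !inE => -[cf f0] [cg g0]; split.
  exact: (is_C2_lin k cf cg).1.
by move=> t tab; rewrite !fctE f0// g0// scaler0 addr0.
Qed.

HB.instance Definition _ (R : realType) (a b : R) :=
  GRing.isSubmodClosed.Build R (R -> R) (C2_pred a b) (C2_submod_closed a b).
HB.instance Definition _ (R : realType) (a b : R) :=
  [SubChoice_isSubLmodule of C2 a b by <:].

Section C2_theory.
Context {R : realType} (a b : R).
Implicit Types (f g : C2 a b).

Lemma C2_is_Cn f : is_Cn 2 a b f.
Proof. by have := C2_funP f; rewrite inE => -[]. Qed.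

Lemma C2_out f t : t \notin `[a, b] -> f t = 0.
Proof. by have := C2_funP f; rewrite inE => -[_]; apply. Qed.

Lemma C2_derivnD f g i t : (i <= 2)%N ->
  derivn_itv a b i (f + g) t = derivn_itv a b i f t + derivn_itv a b i g t.
Proof.
move=> i2; have [_] := is_C2_lin 1 (C2_is_Cn f) (C2_is_Cn g).
by rewrite !scale1r => /(_ i i2) ->; rewrite scale1r.
Qed.

Lemma C2_derivnZ k f i t : (i <= 2)%N ->
  derivn_itv a b i (k *: f) t = k * derivn_itv a b i f t.
Proof.
move=> i2; have [_] := is_C2_lin k (C2_is_Cn f) (C2_is_Cn 0).
by rewrite addr0 => /(_ i i2) ->; rewrite (is_C2_0 a b).2 addr0.
Qed.

Let nrm f : R := normC2 a b f.

Let nrmD f g : nrm (f + g) <= nrm f + nrm g.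
Proof.
apply/(normC2_leP (C2_is_Cn _)); first by rewrite addr_ge0 ?normC2_ge0.
move=> i i2 t tab; rewrite C2_derivnD//; apply: le_trans (ler_normD _ _) _.
by apply: lerD; apply: normC2_ub => //; exact: C2_is_Cn.
Qed.

Let nrm_leZ k f : nrm (k *: f) <= `|k| * nrm f.
Proof.
apply/(normC2_leP (C2_is_Cn _)); first by rewrite mulr_ge0 ?normC2_ge0.
move=> i i2 t tab; rewrite C2_derivnZ// normrM ler_wpM2l//.
by apply: normC2_ub => //; exact: C2_is_Cn.
Qed.

Let nrmZ k f : nrm (k *: f) = `|k| * nrm f.
Proof.
apply/eqP; rewrite eq_le nrm_leZ/=.
have [->|k0] := eqVneq k 0; first by rewrite normr0 mul0r normC2_ge0.
have := nrm_leZ k^-1 (k *: f); rewrite scalerA mulVf// scale1r normfV.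
by rewrite ler_pdivlMl ?normr_gt0.
Qed.

Let nrm0 f : nrm f = 0 -> f = 0.
Proof.
move=> f0; apply/val_inj/funext => t /=.
have [tab|tab] := boolP (t \in `[a, b]); last by rewrite C2_out.
have := @normC2_ub _ _ _ _ 0%N _ (C2_is_Cn f) isT tab.
by rewrite [normC2 _ _ _]f0 normr_le0 => /eqP.
Qed.

HB.instance Definition _ := Lmodule_isNormed.Build R (C2 a b) nrmD nrmZ nrm0.

Lemma C2_normE f : `|f| = normC2 a b f. Proof. by []. Qed.

End C2_theory.

(* The element of [C^2([a, b])] given by a function of class [C^2] on
   [[a, b]]; the default value 0 is used for other functions. *)
Definition toC2 {R : realType} (a b : R) (f : R -> R) : C2 a b :=
  insubd 0 (fun t => if t \in `[a, b] then f t else 0).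

Section C2_examples.
Context {R : realType}.
Implicit Types (a b c d t s l r : R) (f g h : R -> R).

Lemma is_C2_eq a b f g : a < b -> {in `[a, b], f =1 g} ->
  is_Cn 2 a b f -> is_Cn 2 a b g.
Proof.
move=> ab fg /(is_C2P _ ab)[f1 [f2 [H1 H2 c2]]]; apply/is_C2P => //.
exists f1, f2; split=> // t tab.
by apply: has_deriv_itv_eq (H1 t tab).
Qed.

Lemma toC2E a b f t : a < b -> is_Cn 2 a b f -> t \in `[a, b] ->
  toC2 a b f t = f t.
Proof.
move=> ab cf tab; rewrite [LHS](_ : _ = val (toC2 a b f) t)// val_insubd.
case: ifPn => [_|/negP[]]; first by rewrite tab.
apply/asboolP; split; last first.
  by move=> u /negbTE ->.
by apply: is_C2_eq cf => // u /= ->.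
Qed.

Lemma has_deriv_itv_shift a b c d t f s l : t + s \in `[a, b] ->
  (forall u, u \in `[c, d] -> t + u \in `[a, b]) ->
  has_deriv_itv a b f (t + s) l ->
  has_deriv_itv c d (fun u => f (t + u)) s l.
Proof.
move=> tsab cdab H e /H[k k0 {}H]; exists k => // u /cdab uab us.
have E : u - s = (t + u) - (t + s) by ring.
by rewrite E; apply: H => //; rewrite -E.
Qed.

Lemma is_C2_shift a b c d t f : a < b -> c < d ->
  (forall u, u \in `[c, d] -> t + u \in `[a, b]) -> is_Cn 2 a b f ->
  is_Cn 2 c d (fun u => f (t + u)) /\
  forall u, u \in `[c, d] -> forall i, (i <= 2)%N ->
    derivn_itv c d i (fun u => f (t + u)) u = derivn_itv a b i f (t + u).
Proof.
move=> ab cd cdab /(is_C2P _ ab)[f1 [f2 [H1 H2 c2]]].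
have G1 u : u \in `[c, d] ->
    has_deriv_itv c d (fun u => f (t + u)) u (f1 (t + u)).
  by move=> ucd; apply: (has_deriv_itv_shift _ cdab); [exact: cdab|exact/H1/cdab].
have G2 u : u \in `[c, d] ->
    has_deriv_itv c d (fun u => f1 (t + u)) u (f2 (t + u)).
  by move=> ucd; apply: (has_deriv_itv_shift _ cdab); [exact: cdab|exact/H2/cdab].
split.
  apply/is_C2P => //; exists (fun u => f1 (t + u)), (fun u => f2 (t + u)).
  split=> //; apply/within_itv_continuousP => s scd e e0.
  move/within_itv_continuousP : c2 => /(_ _ (cdab _ scd) _ e0)[k k0 K].
  exists k => // u ucd us; apply: K; first exact: cdab.
  by rewrite opprD addrACA subrr add0r.
move=> u ucd i i2.
have [E1 E2] := is_C2_derivE ab H1 H2 (cdab _ ucd).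
have [E1' E2'] := is_C2_derivE cd G1 G2 ucd.
case: i i2 => [|[|[|//]]] _ //; first by rewrite E1 E1'.
by rewrite E2 E2'.
Qed.

Let glue_far a b t (P : R -> Prop) : t \notin `[a, b] ->
  exists2 d, 0 < d & forall s, s \in `[a, b] -> `|s - t| < d -> P s.
Proof.
rewrite in_itv/= negb_and -!ltNge => /orP[ta|bt].
  exists (a - t); first by rewrite subr_gt0.
  move=> s; rewrite in_itv/= => /andP[as_ _].
  by rewrite ger0_norm; lra.
exists (t - b); first by rewrite subr_gt0.
move=> s; rewrite in_itv/= => /andP[_ sb].
by rewrite ler0_norm; lra.
Qed.

Let glue a b c t (P : R -> Prop) :
  (t \in `[a, b] -> exists2 d, 0 < d &
    forall s, s \in `[a, b] -> `|s - t| < d -> P s) ->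
  (t \in `[b, c] -> exists2 d, 0 < d &
    forall s, s \in `[b, c] -> `|s - t| < d -> P s) ->
  exists2 d, 0 < d & forall s, s \in `[a, c] -> `|s - t| < d -> P s.
Proof.
move=> H1 H2.
have [d1 d10 {}H1] : exists2 d, 0 < d &
    forall s, s \in `[a, b] -> `|s - t| < d -> P s.
  by have [|/glue_far] := boolP (t \in `[a, b]); [exact: H1|apply].
have [d2 d20 {}H2] : exists2 d, 0 < d &
    forall s, s \in `[b, c] -> `|s - t| < d -> P s.
  by have [|/glue_far] := boolP (t \in `[b, c]); [exact: H2|apply].
exists (Num.min d1 d2); first by rewrite lt_min d10.
move=> s; rewrite in_itv/= lt_min => /andP[as_ sc] /andP[sd1 sd2].
have [sb|/ltW bs] := leP s b.
  by apply: H1 => //; rewrite in_itv/= as_.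
by apply: H2 => //; rewrite in_itv/= bs.
Qed.

Lemma is_C2_glue a b c f g h : a < b -> b < c ->
  (forall t, t \in `[a, b] -> has_deriv_itv a b f t (g t)) ->
  (forall t, t \in `[b, c] -> has_deriv_itv b c f t (g t)) ->
  (forall t, t \in `[a, b] -> has_deriv_itv a b g t (h t)) ->
  (forall t, t \in `[b, c] -> has_deriv_itv b c g t (h t)) ->
  {within `[a, b], continuous h} -> {within `[b, c], continuous h} ->
  is_Cn 2 a c f.
Proof.
move=> ab bc f1 f2 g1 g2 /within_itv_continuousP c1.
move=> /within_itv_continuousP c2.
apply/is_C2P; first exact: lt_trans bc.
exists g, h; split.
- move=> t tac e e0; apply: (@glue a b c); first by move=> /f1; apply.
  by move=> /f2; apply.
- move=> t tac e e0; apply: (@glue a b c); first by move=> /g1; apply.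
  by move=> /g2; apply.
- apply/within_itv_continuousP => t tac e e0; apply: (@glue a b c).
    by move=> /c1; apply.
  by move=> /c2; apply.
Qed.

Lemma has_deriv_itv_quadratic a b (p q w : R) t :
  has_deriv_itv a b (fun t => p + t * q + t ^+ 2 / 2 * w) t (q + t * w).
Proof.
move=> e e0; have w0 : 0 < `|w| + 1 by rewrite ltr_wpDl.
exists (e / (`|w| + 1)); first by rewrite divr_gt0.
move=> s _; rewrite ltr_pdivlMr// => st.
rewrite (_ : _ - _ = (s - t) / 2 * w * (s - t)); last by field.
rewrite normrM ler_wpM2r// normrM normrM (@ger0_norm _ 2^-1)//.
by move: st (normr_ge0 w) (normr_ge0 (s - t)); nra.
Qed.

Lemma has_deriv_itv_affine a b (q w : R) t :
  has_deriv_itv a b (fun t => q + t * w) t w.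
Proof.
move=> e e0; exists 1 => // s _ _.
rewrite (_ : _ - _ = 0); last by ring.
by rewrite normr0 mulr_ge0// ltW.
Qed.

End C2_examples.

(* The extension of [psi] from [[- r, 0]] to [[- r, 1]] by its Taylor
   polynomial of order 2 at 0. *)
Definition psi_ext {R : realType} (r : R) (psi : R -> R) : R -> R := fun t =>
  if t <= 0 then psi t
  else psi 0 + t * derivn_itv (- r) 0 1 psi 0 +
       t ^+ 2 / 2 * derivn_itv (- r) 0 2 psi 0.

Definition psi_hat {R : realType} (r : R) (psi : C2 (- r) 0) : C2 (- r) 1 :=
  toC2 (- r) 1 (psi_ext r psi).

Definition segment {R : realType} (r : R) (u : C2 (- r) 1) (t : R) :
  C2 (- r) 0 := toC2 (- r) 0 (fun theta => u (t + theta)).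

Section psi_hat_segment.
Context {R : realType} (r : R) (r_gt0 : 0 < r).

Lemma psi_ext_C2 (psi : C2 (- r) 0) : is_Cn 2 (- r) 1 (psi_ext r psi).
Proof.
have r0 : - r < 0 by rewrite oppr_lt0.
have [g [h [fg gh ch]]] := iffLR (is_C2P _ r0) (C2_is_Cn psi).
have z0 : 0 \in `[- r, 0] by rewrite in_itv/= lexx andbT ltW.
have [E1 E2] := is_C2_derivE r0 fg gh z0.
pose pf : R -> R := fun t => psi 0 + t * g 0 + t ^+ 2 / 2 * h 0.
pose pg : R -> R := fun t => g 0 + t * h 0.
pose G t := if t <= 0 then g t else pg t.
pose H t := if t <= 0 then h t else h 0.
have left (k k' : R -> R) : {in `[- r, 0], k =1 fun t => if t <= 0 then k t else k' t}.
  by move=> t; rewrite in_itv/= => /andP[_ ->].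
have right (k k' : R -> R) : k 0 = k' 0 ->
    {in `[0, 1], k' =1 fun t => if t <= 0 then k t else k' t}.
  move=> k0 t; rewrite in_itv/= => /andP[t0 _].
  case: ifPn => // t0'; have -> : t = 0 by apply/le_anti; rewrite t0 t0'.
  by [].
have zE (t : R) : t \in `[- r, 0] -> t <= 0 by rewrite in_itv/= => /andP[].
rewrite /psi_ext E1 E2.
apply: (@is_C2_glue _ (- r) 0 1 _ G H) => //.
- move=> t tr; rewrite /G (zE _ tr).
  by apply: has_deriv_itv_eq (fg t tr) => //; exact: left.
- move=> t t01.
  have <- : pg t = G t by apply: (right g pg) => //; rewrite /pg mul0r addr0.
  apply: (@has_deriv_itv_eq _ _ _ pf) => //; last first.
    exact: has_deriv_itv_quadratic.
  by apply: right; rewrite /pf expr0n/= !mul0r !addr0.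
- move=> t tr; rewrite /H (zE _ tr).
  by apply: has_deriv_itv_eq (gh t tr) => //; exact: left.
- move=> t t01.
  have <- : h 0 = H t by apply: (right h (cst (h 0))).
  apply: (@has_deriv_itv_eq _ _ _ pg) => //; last exact: has_deriv_itv_affine.
  by apply: right; rewrite /pg mul0r addr0.
- by apply: within_itv_continuous_eq ch; exact: left.
- apply: (@within_itv_continuous_eq _ _ _ (cst (h 0))); first exact: right.
  by move=> x; exact: cvg_cst.
Qed.

Lemma psi_hatE (psi : C2 (- r) 0) t : t \in `[- r, 1] ->
  psi_hat psi t = psi_ext r psi t.
Proof.
by apply: toC2E (psi_ext_C2 psi); rewrite (@lt_trans _ _ 0)// oppr_lt0.
Qed.

Lemma segmentE (u : C2 (- r) 1) t theta : t \in `[0, 1] ->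
  theta \in `[- r, 0] -> segment u t theta = u (t + theta).
Proof.
move=> t01; apply: toC2E; first by rewrite oppr_lt0.
apply: (is_C2_shift _ _ _ (C2_is_Cn u)).1; [move: r_gt0; lra|move: r_gt0; lra|].
by move=> s; move: t01; rewrite !in_itv/= => /andP[? ?] /andP[? ?]; apply/andP; split; lra.
Qed.

End psi_hat_segment.

Definition gamma3 {R : realType} (t : R) : R := t ^+ 3 / 6.

Definition kfun {R : realType} (t s : R) : R :=
  6^-1 * (if t <= s then t ^+ 3 else s * (3 * t ^+ 2 - 3 * t * s + s ^+ 2)).

Definition K0 {R : realType} (r : R) : set (C2 (- r) 1) :=
  [set u | (forall t, t \in `[- r, 1] -> 0 <= u t) /\
           (forall t, t \in `[- r, 0] ->
              [/\ u t = 0, derivn_itv (- r) 1 1 u t = 0 &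
                  derivn_itv (- r) 1 2 u t = 0])].

Definition K0_ball {R : realType} (r rho : R) : set (C2 (- r) 1) :=
  [set u | K0 u /\ normC2 0 1 u < rho].

Definition Kpsi {R : realType} (r : R) (psi : C2 (- r) 0) :
  set (C2 (- r) 1) := [set psi_hat psi + v | v in K0 (r := r)].

Definition Kpsi_ball {R : realType} (r : R) (psi : C2 (- r) 0) (rho : R) :
  set (C2 (- r) 1) := [set psi_hat psi + v | v in K0_ball rho].

(* Closure and boundary are taken in the subspace topology of [Kpsi psi]. *)
Definition Kpsi_closure {R : realType} (r : R) (psi : C2 (- r) 0) (rho : R) :
  set (C2 (- r) 1) := @closure (subspace (Kpsi psi)) (Kpsi_ball psi rho).

Definition Kpsi_boundary {R : realType} (r : R) (psi : C2 (- r) 0) (rho : R) :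
  set (C2 (- r) 1) :=
  Kpsi_closure psi rho `\`
  @interior (subspace (Kpsi psi)) (Kpsi_ball psi rho).

Section Kpsi_theory.
Context {R : realType} (r : R) (r_gt0 : 0 < r).
Implicit Types (v : C2 (- r) 1) (psi : C2 (- r) 0) (rho : R).

Lemma K0_normE v : K0 v -> normC2 0 1 v = `|v|.
Proof.
move=> [_ v0]; rewrite C2_normE.
have r1 : - r < 1 by move: r_gt0; lra.
have sub u : u \in `[0, 1] -> 0 + u \in `[- r, 1].
  by move: r_gt0; rewrite add0r !in_itv/= => ? /andP[? ?]; apply/andP; split; lra.
have := is_C2_shift r1 ltr01 sub (C2_is_Cn v).
have -> : (fun u => v (0 + u)) = v by apply/funext => u; rewrite add0r.
move=> [c01 E].
apply/eqP; rewrite eq_le; apply/andP; split.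
  apply/(normC2_leP c01); first exact: normC2_ge0.
  move=> i i2 t t01.
  rewrite E// add0r; apply: normC2_ub => //; first exact: C2_is_Cn.
  by rewrite -[t]add0r; exact: sub.
apply/(normC2_leP (C2_is_Cn v)); first exact: normC2_ge0.
move=> i i2 t tr1; have [t0|/ltW t0] := leP t 0.
  have tr0 : t \in `[- r, 0].
    by move: tr1; rewrite !in_itv/= t0 andbT => /andP[].
  have [v0' v1 v2] := v0 t tr0.
  rewrite (_ : derivn_itv _ _ _ _ _ = 0) ?normr0 ?normC2_ge0//.
  by case: i i2 => [|[|[|//]]].
have t01 : t \in `[0, 1] by move: tr1; rewrite !in_itv/= t0 => /andP[].
by rewrite -{1}[t]add0r -E//; exact: normC2_ub.
Qed.

Lemma K0_scale (c : R) v : 0 <= c -> K0 v -> K0 (c *: v).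
Proof.
move=> c0 [v0 v1]; split=> [t tr1|t tr0].
  by have := @C2_derivnZ _ _ _ c v 0%N t isT => /= ->; rewrite mulr_ge0// v0.
have [e0 e1 e2] := v1 t tr0; split.
- by have := @C2_derivnZ _ _ _ c v 0%N t isT => /= ->; rewrite e0 mulr0.
- by rewrite C2_derivnZ// e1 mulr0.
- by rewrite C2_derivnZ// e2 mulr0.
Qed.

Lemma Kpsi_ballE psi rho :
  Kpsi_ball psi rho = [set u | `|u - psi_hat psi| < rho] `&` Kpsi psi.
Proof.
apply/seteqP; split=> [_ [v [Kv vr] <-]|u [/= ur [v Kv uE]]].
  split; last by exists v.
  by rewrite /= addrC addKr -K0_normE.
exists v => //; split=> //; rewrite K0_normE//.
by move: ur; rewrite -uE addrC addKr.
Qed.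

Let dist_continuous psi : continuous (fun u : C2 (- r) 1 => `|u - psi_hat psi|).
Proof.
move=> u; apply: (@cvg_norm _ _ _ (nbhs u)).
by apply: cvgB; [exact: cvg_id|exact: cvg_cst].
Qed.

Let ball_interior psi rho :
  @interior (subspace (Kpsi psi)) (Kpsi_ball psi rho) = Kpsi_ball psi rho.
Proof.
apply/seteqP; split; first exact: interior_subset.
suff : @open (subspace (Kpsi psi)) (Kpsi_ball psi rho).
  by rewrite openE.
rewrite Kpsi_ballE open_subspaceIT; apply: open_subspaceW.
apply: (@open_comp _ _ (fun u => `|u - psi_hat psi|) [set x | x < rho]).
  by move=> x _; exact: dist_continuous.
exact: open_lt.
Qed.

Lemma Kpsi_closureE psi rho : 0 < rho -> Kpsi_closure psi rho =
  [set psi_hat psi + v | v in [set v | K0 v /\ normC2 0 1 v <= rho]].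
Proof.
move=> rho0; set E := [set _ | _ in _].
have EE : E = [set u | `|u - psi_hat psi| <= rho] `&` Kpsi psi.
  apply/seteqP; split=> [_ [v [Kv vr] <-]|u [/= ur [v Kv uE]]].
    split; last by exists v.
    by rewrite /= addrC addKr -K0_normE.
  exists v => //; split=> //; rewrite K0_normE//.
  by move: ur; rewrite -uE addrC addKr.
apply/seteqP; split.
  have cE : @closed (subspace (Kpsi psi)) E.
    rewrite EE; apply: closedI; last exact: closed_subspaceT.
    apply: closed_subspaceW.
    apply: (@preimage_closed _ _ (fun u => `|u - psi_hat psi|) [set x | x <= rho]).
      by move=> x _; exact: dist_continuous.
    exact: closed_le.
  have /(@closureS (subspace (Kpsi psi))) : Kpsi_ball psi rho `<=` E.
    by rewrite EE Kpsi_ballE => u [/= ur Ku]; split=> //=; exact: ltW.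
  by rewrite -(iffLR (closure_id _) cE).
move=> u [v [Kv]]; rewrite K0_normE// => vr <-{u} B /=.
rewrite -[nbhs _]nbhs_subspace_in; last by exists v.
move=> /nbhs_ballP[d /= d0 H].
have v0 := normr_ge0 v.
have v1 : 0 < `|v| + 1 by lra.
pose e := Num.min 1 (d / 2 / (`|v| + 1)).
have e0 : 0 < e by rewrite lt_min ltr01/= !divr_gt0.
have e1 : e <= 1 by rewrite ge_min lexx.
have ed : e * (`|v| + 1) <= d / 2 by rewrite -ler_pdivlMr// ge_min lexx orbT.
have Kw : K0 ((1 - e) *: v) by apply: K0_scale => //; lra.
have nw : normC2 0 1 ((1 - e) *: v) < rho.
  rewrite K0_normE// normrZ ger0_norm; last lra.
  by nra.
exists (psi_hat psi + (1 - e) *: v); split; first by exists ((1 - e) *: v).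
apply: H; last by exists ((1 - e) *: v).
rewrite -ball_normE/= opprD addrACA subrr add0r scalerBl scale1r opprB.
by rewrite addrC subrK normrZ gtr0_norm//; nra.
Qed.

Lemma Kpsi_boundaryE psi rho : 0 < rho -> Kpsi_boundary psi rho =
  [set psi_hat psi + v | v in [set v | K0 v /\ normC2 0 1 v = rho]].
Proof.
move=> rho0; rewrite /Kpsi_boundary ball_interior Kpsi_closureE//.
apply/seteqP; split=> [_ [[v [Kv vr] <-] nv]|_ [v [Kv vr] <-]].
  exists v => //; split=> //; apply/eqP; rewrite eq_le vr/= leNgt.
  by apply/negP => vr'; apply: nv; exists v.
split; first by exists v => //; split=> //; rewrite vr.
move=> [w [Kw wr]] /addrI wv; move: wr.
by rewrite wv vr ltxx.
Qed.

End Kpsi_theory.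

(* Measurability with respect to the Lebesgue sigma-algebra of the line, i.e.
   the completion of the Borel one. *)
Definition lebesgue_measurable_fun {R : realType} (D : set R) (f : R -> R) :
  Prop := @measurable_fun _ _
    (caratheodory_type ((wlength (@idfun R))^*)%mu) (measurableTypeR R) D f.

Definition Linfty {R : realType} (a b : R) (f : R -> R) : Prop :=
  lebesgue_measurable_fun `[a, b] f /\
  exists M, {ae lebesgue_measure, forall t, t \in `[a, b] -> `|f t| <= M}.

Definition abs_continuous {R : realType} (a b : R) (f : R -> R) : Prop :=
  forall e, 0 < e -> exists2 d, 0 < d &
    forall (n : nat) (x y : 'I_n -> R),
      (forall i, a <= x i <= y i /\ y i <= b) ->
      (forall i j, i != j -> y i <= x j \/ y j <= x i) ->
      \sum_(i < n) (y i - x i) < d ->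
      \sum_(i < n) `|f (y i) - f (x i)| < e.

(* Caratheodory solutions of [u'''' (t) + lambda * F t u_t = 0] on [[0, 1]],
   [u = psi] on [[- r, 0]], [u''' 1 = lambda * B u]. *)
Definition is_solution {R : realType} (r : R) (psi : C2 (- r) 0)
    (F : R -> C2 (- r) 0 -> R) (B : C2 (- r) 1 -> R)
    (lambda : R) (u : C2 (- r) 1) : Prop :=
  [/\ is_Cn 3 0 1 u,
      abs_continuous 0 1 (derivn_itv 0 1 3 u),
      {ae lebesgue_measure, forall t, t \in `[0, 1] ->
         derivable_itv 0 1 (derivn_itv 0 1 3 u) t /\
         derivn_itv 0 1 4 u t + lambda * F t (segment u t) = 0},
      (forall t, t \in `[- r, 0] -> u t = psi t) &
      derivn_itv 0 1 3 u 1 = lambda * B u].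

(* Main.v *)
(* Look for [u = psi_hat + v] where [w = v''] is nondecreasing on [[0, 1]] from 0
   to [rho]; then [v] lies in the cone and its norm is exactly [rho]. For such a
   [w] let [b = B u], let [g s = F s u_s], and let [H] solve [H'' = - g],
   [H 0 = 0], [H' 1 = b]. The solution of [v'''' = - lambda * g],
   [v''' 1 = lambda * b] has second derivative [lambda * H], and
   [H 1 = b + \int_0^1 s * g s] is bounded below by a positive constant, because
   [kfun t s <= s] on the unit square. Hence choosing [lambda = rho / H 1] turns
   the eigenvalue problem into a fixed point problem [w = rho * H / H 1] on the
   convex set of nondecreasing profiles from 0 to [rho].

   The profiles that are affine on the [n] cells of a regular subdivision form
   an [(n - 1)]-simplex, on which Brouwer's theorem applies. Since the profiles
   [rho * H / H 1] are uniformly Lipschitz, a limit of these discrete fixed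
   points exists and is a fixed point. Brouwer's theorem itself follows from
   Scarf's lemma on dominant sets of points for several total orders, in the
   formulation of Petri and Voorneveld ("No bullying"). *)

Require Import Defs.
From HB Require Import structures.
From mathcomp Require Import all_boot.
From mathcomp Require Import zify.

Set Implicit Arguments.
Unset Strict Implicit.
Unset Printing Implicit Defensive.

(** * Scarf's lemma *)

(** The sphere [normC2 0 1 v = rho] of the cone is not convex. Convexity is recovered on the part of
    it where [v''] is nondecreasing: the interval has length 1, so [v] and [v'] never exceed the
    bound on [v''], and the norm is attained by [v''] at 1. The map preserves this part because [F]
    and [B] are nonnegative: [H' t] is [b] plus the integral of [g] over [[t, 1]]. The kernel is the
    second derivative of [kfun] in its first argument, namely [min (t, s)], while [gamma3] becomes
    [t]. The hypotheses on [F] hold only almost everywhere, so [s |-> F s u_s] is replaced by a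
    bounded Borel function equal to it almost everywhere. Which one is chosen does not matter, since
    it acts only through integrals. Continuity of the map is needed only in a weak form: uniform
    convergence of profiles must give pointwise convergence of their images, which is dominated
    convergence. *)

Section dominance.
Variables (T I : finType) (key : I -> T -> nat).
Hypothesis key_inj : forall i, injective (key i).
Implicit Types (D : {set T}) (C : {set I}) (i j k l : I) (x y : T).

(** Contrapositively, no point of [T] lies strictly above some element of [D] for each order of
    [C]. *)
Definition dominant D C :=
  [forall y, exists i in C, forall x in D, key i y <= key i x].

Lemma dominantP D C : reflect
  (forall y, exists2 i, i \in C & forall x, x \in D -> key i y <= key i x)
  (dominant D C).
Proof.
apply: (iffP forallP) => H y.
  by have /exists_inP[i iC /forall_inP] := H y; exists i.
by have [i iC Hi] := H y; apply/exists_inP; exists i => //; apply/forall_inP.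
Qed.

(** Rooms play the part of the full cells of a triangulation. Dominant pairs with one order more
    than points, called doors, play the part of facets. By [adjacent], a door leads to a room by
    gaining a point or by losing an order. *)
Definition room (p : {set T} * {set I}) :=
  [&& dominant p.1 p.2, #|p.1| == #|p.2| & p.2 != set0].

Definition adjacent (d r : {set T} * {set I}) :=
  [exists x, (x \notin d.1) && (r == (x |: d.1, d.2))] ||
  [exists i, (i \notin r.2) && (d == (r.1, i |: r.2))].

(** * The two rooms on either side of a door *)

Section door.
Variables (D : {set T}) (C : {set I}).
Hypotheses (domDC : dominant D C) (cardC : #|C| = #|D|.+1).
Variable m : I -> T.
Hypotheses (mD : forall i, m i \in D)
  (m_min : forall i x, x \in D -> key i (m i) <= key i x).

(** These points are the obstruction to dropping the order [k] from the door. If there are none,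
    dropping [k] keeps dominance; otherwise the largest of them for [key k] is the point to add.
    This is the alternative in [opposite]. *)
Let above k := [set y | [forall l in C :\ k, key l (m l) < key l y]].

Let aboveP k y :
  reflect (forall l, l \in C -> l != k -> key l (m l) < key l y) (y \in above k).
Proof.
rewrite inE; apply: (iffP forall_inP) => H l.
  by move=> lC lk; apply: H; rewrite !inE lk.
by rewrite !inE => /andP[lk lC]; exact: H.
Qed.

Let opposite k r := (above k == set0) && (r == (D, C :\ k)) ||
  [exists y in above k, [forall z in above k, key k z <= key k y] &&
     (r == (y |: D, C))].

Let m_surj x : x \in D -> exists2 i, i \in C & m i = x.
Proof.
move=> xD; have [i iC Hi] := dominantP _ _ domDC x; exists i => //.
by apply: (@key_inj i); apply/eqP; rewrite eqn_leq m_min// Hi.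
Qed.

Let exists_opposite k : exists r, opposite k r.
Proof.
rewrite /opposite; have [e|/set0Pn[y0 y0k]] := eqVneq (above k) set0.
  by exists (D, C :\ k); rewrite eqxx.
case: (@arg_maxnP _ y0 (mem (above k)) (key k) y0k) => y yk ymax.
exists (y |: D, C); apply/orP; right; apply/exists_inP; exists y => //.
by rewrite eqxx andbT; apply/forall_inP.
Qed.

Let opposite_uniq k r r' : opposite k r -> opposite k r' -> r = r'.
Proof.
case/orP=> [/andP[/eqP e /eqP->]|/exists_inP[y yk /andP[/forall_inP ym /eqP->]]];
case/orP=> [/andP[/eqP e' /eqP->]|/exists_inP[z zk /andP[/forall_inP zm /eqP->]]] //.
- by move: zk; rewrite e inE.
- by move: yk; rewrite e' inE.
have -> // : y = z.
by apply: (@key_inj k); apply/eqP; rewrite eqn_leq ym// zm.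
Qed.

(** By [m_surj] the minima map [C] onto [D], and [C] has just one element more. So exactly two
    orders share a minimum, and those two are the free ones. *)
Let free k := k \in C /\ {in C :\ k &, injective m}.

Let free_surj k x : free k -> x \in D -> exists2 i, i \in C :\ k & m i = x.
Proof.
move=> [kC kinj] xD.
have /eqP : m @: (C :\ k) = D.
  apply/eqP; rewrite eqEcard; apply/andP; split.
    by apply/subsetP => _ /imsetP[i _ ->].
  by rewrite card_in_imset//; have := cardsD1 k C; rewrite kC cardC; lia.
by rewrite eqEsubset => /andP[_ /subsetP/(_ _ xD)/imsetP[i iC ->]]; exists i.
Qed.

Let free_above k y : free k -> y \in above k -> y \notin D.
Proof.
move=> fk /aboveP yk; apply/negP => /(free_surj fk)[i].
by rewrite !inE => /andP[ik iC] iy; have := yk _ iC ik; rewrite iy ltnn.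
Qed.

Let opposite_room k r : free k -> opposite k r -> room r && adjacent (D, C) r.
Proof.
move=> fk; have [kC kinj] := fk; rewrite /adjacent.
have cDk : #|C :\ k| = #|D| by have := cardsD1 k C; rewrite kC cardC; lia.
case/orP=> [/andP[/eqP e /eqP->]|/exists_inP[y yk /andP[/forall_inP ym /eqP->]]].
  apply/andP; split; last first.
    by apply/orP; right; apply/existsP; exists k; rewrite /= !inE eqxx/= setD1K.
  rewrite /room /= cDk eqxx /=; apply/andP; split; last first.
    have: 0 < #|D| by apply/card_gt0P; exists (m k).
    by rewrite -cDk card_gt0.
  apply/dominantP => y; have : y \notin above k by rewrite e inE.
  rewrite inE => /forall_inPn[l lC]; rewrite -leqNgt => yl; exists l => //.
  by move=> x xD; apply: leq_trans yl (m_min _ xD).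
have yD := free_above fk yk.
apply/andP; split; last first.
  by apply/orP; left; apply/existsP; exists y; rewrite /= yD eqxx.
rewrite /room /= cardsU1 yD cardC eqxx /=; apply/andP; split; last first.
  by apply/set0Pn; exists k.
move/aboveP in yk.
(* Dominance puts [y] below [D] in some order of [C]; membership in [above k] excludes every order
   other than [k]. *)
have yk' : key k y <= key k (m k).
  have [l lC Hl] := dominantP _ _ domDC y.
  have [<-|lk] := eqVneq l k; first exact: Hl.
  by have := yk _ lC lk; have := Hl _ (mD l); lia.
apply/dominantP => z; have [zk|] := boolP (z \in above k).
  exists k => // x; rewrite inE => /orP[|xD]; first by rewrite inE => /eqP ->; exact: ym.
  by apply: leq_trans (ym _ zk) (leq_trans yk' (m_min _ xD)).
rewrite inE => /forall_inPn[l]; rewrite !inE => /andP[lk lC]; rewrite -leqNgt => zl.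
exists l => // x; rewrite inE => /orP[|xD].
  by rewrite inE => /eqP ->; have := yk _ lC lk; lia.
exact: leq_trans zl (m_min _ xD).
Qed.

Let room_opposite r : room r -> adjacent (D, C) r -> exists2 k, free k & opposite k r.
Proof.
have card_free k : k \in C -> D \subset m @: (C :\ k) -> free k.
  move=> kC sub; split=> //; apply/imset_injP.
  rewrite eqn_leq leq_imset_card /=; have := subset_leq_card sub.
  by have := cardsD1 k C; rewrite kC cardC; lia.
case: r => D' C' /and3P[/= /dominantP dom /eqP card _] /orP[/existsP[y]|/existsP[k]] /=.
  case/andP=> yD /eqP[eD eC]; subst D' C'.
  have [k kC ky] := dom y.
  (* If [y] were below [D] in the order [l] as well, each point of [D] would have to be least in an
     order of [C] other than [k] and [l], and only [#|D| - 1] of these remain. *)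
  have ymk l : l \in C -> l != k -> key l (m l) < key l y.
    move=> lC lk; rewrite ltnNge; apply/negP => yl.
    suff : #|D| <= #|(C :\ k) :\ l|.
      have := cardsD1 k C; have := cardsD1 l (C :\ k).
      by rewrite !inE lk lC kC cardC; lia.
    apply: leq_trans (leq_imset_card m _); apply: subset_leq_card.
    apply/subsetP => x xD; have [j jC jx] := dom x.
    have mj : m j = x.
      apply: (@key_inj j); apply/eqP; rewrite eqn_leq m_min//= jx//.
      by rewrite inE mD orbT.
    rewrite -mj; apply: imset_f; rewrite !inE jC andbT.
    have neq j' : key j' y <= key j' (m j') -> j != j'.
      move=> yj'; apply: contra_neq (_ : x != y) => [jj'|]; last first.
        by apply: contraNneq yD => <-.
      rewrite -jj' mj in yj'; apply: (@key_inj j); apply/eqP.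
      by rewrite eqn_leq yj' jx// inE inE eqxx.
    by rewrite !neq// ky// inE mD orbT.
  have fk : free k.
    apply: card_free => //; apply/subsetP => x xD.
    have [j jC jx] := dom x.
    have mj : m j = x.
      apply: (@key_inj j); apply/eqP; rewrite eqn_leq m_min//= jx//.
      by rewrite inE mD orbT.
    rewrite -mj; apply: imset_f; rewrite !inE jC andbT.
    apply: contraNneq yD => jk; have -> // : y = x.
    apply: (@key_inj k); apply/eqP; rewrite eqn_leq ky ?inE ?xD ?orbT//=.
    by rewrite -jk jx// inE inE eqxx.
  exists k => //; apply/orP; right; apply/exists_inP; exists y; first exact/aboveP.
  rewrite eqxx andbT; apply/forall_inP => z /aboveP zk.
  have [l lC zl] := dom z; have [<-|lk] := eqVneq l k; first by rewrite zl// !inE eqxx.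
  by have := zk _ lC lk; have := zl (m l); rewrite inE mD orbT => /(_ isT); lia.
case/andP=> kC' /eqP[eD eC]; subst D' C.
have eC' : (k |: C') :\ k = C' by rewrite setU1K.
exists k.
  apply: card_free; first by rewrite !inE eqxx.
  rewrite eC'; apply/subsetP => x xD; have [i iC Hi] := dom x.
  apply/imsetP; exists i => //.
  by apply: (@key_inj i); apply/eqP; rewrite eqn_leq m_min// Hi.
apply/orP; left; rewrite eC' eqxx andbT; apply/eqP/setP => y; rewrite in_set0.
apply/negP => /aboveP ya; have [l lC Hl] := dom y.
have := ya l; rewrite !inE lC orbT; have -> : l != k by apply: contraNneq kC' => <-.
by move=> /(_ isT isT); have := Hl _ (mD l); lia.
Qed.

(** Each of the two free orders [i], [j] yields one room. The two rooms differ: a common one would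
    add a single point beating the minima of [D] in all orders but [i] and in all but [j], hence in
    all of [C], against dominance. *)
Lemma card_rooms_of_door : #|[set r | room r && adjacent (D, C) r]| = 2.
Proof.
have mim : m @: C \subset D by apply/subsetP => _ /imsetP[i _ ->].
have : ~~ [forall i in C, forall j in C, (m i == m j) ==> (i == j)].
  apply/negP => /forall_inP H; have := subset_leq_card mim.
  rewrite card_in_imset ?cardC ?ltnn// => i j iC jC mij.
  by have /forall_inP/(_ _ jC)/implyP := H i iC; rewrite mij => /(_ (eqxx _))/eqP.
case/forall_inPn => i iC /forall_inPn[j jC]; rewrite negb_imply => /andP[/eqP mij ij].
have sub k k' : k \in C -> k' \in C -> k != k' -> m k = m k' -> free k.
  move=> kC k'C kk' mk; split=> //; apply/imset_injP.
  rewrite eqn_leq leq_imset_card /=.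
  have : D \subset m @: (C :\ k).
    apply/subsetP => x /m_surj[l lC <-]; have [->|lk] := eqVneq l k.
      by rewrite mk imset_f// !inE eq_sym kk'.
    by rewrite imset_f// !inE lk.
  by move=> /subset_leq_card; have := cardsD1 k C; rewrite kC cardC; lia.
have fi : free i by exact: (sub i j).
have fj : free j by apply: (sub j i) => //; rewrite eq_sym.
have [ri oi] := exists_opposite i; have [rj oj] := exists_opposite j.
have neq : ri != rj.
  apply/eqP => e; rewrite -e in oj.
  case/orP: oi => [/andP[/eqP ei /eqP eri]|/exists_inP[y yi /andP[_ /eqP eri]]];
  case/orP: oj => [/andP[/eqP ej /eqP erj]|/exists_inP[z zj /andP[_ /eqP erj]]].
  - have [/setP/(_ i)] : C :\ i = C :\ j by rewrite eri in erj; case: erj.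
    by rewrite !inE eqxx ij iC.
  - have zD := free_above fj zj.
    have [/setP/(_ z)] : D = z |: D by rewrite eri in erj; case: erj.
    by rewrite !inE eqxx (negbTE zD).
  - have yD := free_above fi yi.
    have [/setP/(_ y)] : y |: D = D by rewrite eri in erj; case: erj.
    by rewrite !inE eqxx (negbTE yD).
  - have yD := free_above fi yi.
    have yz : y = z.
      have /setP/(_ y) : y |: D = z |: D by rewrite eri in erj; case: erj.
      by rewrite !inE eqxx (negbTE yD) !orbF => h; apply/eqP; rewrite -h.
    have [l lC Hl] := dominantP _ _ domDC y.
    have Hl' := Hl _ (mD l); move/aboveP: yi => yi; move/aboveP: zj => zj.
    have [li|li] := eqVneq l i.
      have := zj l lC; rewrite li ij => /(_ isT); rewrite -yz -li.
      by move: Hl'; lia.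
    by have := yi _ lC li; move: Hl'; lia.
have -> : [set r | room r && adjacent (D, C) r] = [set ri; rj].
  apply/setP => r; rewrite !inE; apply/idP/idP.
    case/andP=> rr ra; have [k fk ok] := room_opposite rr ra.
    have kij : (k == i) || (k == j).
      rewrite -[_ || _]negbK negb_or; apply/negP => /andP[ki kj].
      have [_ kinj] := fk; move: ij; rewrite (kinj i j) ?eqxx ?inE//.
      - by rewrite eq_sym ki.
      - by rewrite eq_sym kj.
    case/orP: kij => /eqP ek; rewrite ek in ok.
      by rewrite (opposite_uniq ok oi) eqxx.
    by rewrite (opposite_uniq ok oj) eqxx orbT.
  by case/orP=> /eqP ->; [exact: opposite_room oi|exact: opposite_room oj].
by rewrite cards2 neq.
Qed.

End door.

(** With a single order, only its greatest element forms a dominant singleton, and the order cannot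
    be dropped because a room keeps at least one. This lone room makes the final count odd. *)
Lemma card_rooms_of_outside_door (i : I) (t : T) :
  #|[set r | room r && adjacent (set0, [set i]) r]| = 1.
Proof.
case: (@arg_maxnP _ t predT (key i) isT) => y _ ymax.
rewrite (_ : [set _ | _] = [set ([set y], [set i])]) ?cards1//.
apply/setP => -[D C]; rewrite !inE /adjacent /room /=; apply/idP/idP.
  case/andP=> /and3P[/dominantP dom _ C0] /orP[/existsP[x]|/existsP[j]].
    rewrite inE setU0 => /andP[_ /eqP[eD eC]]; subst D C; rewrite xpair_eqE eqxx andbT.
    have [j] := dom y; rewrite inE => /eqP -> /(_ x); rewrite inE eqxx => /(_ isT) yx.
    have -> // : x = y; apply: (@key_inj i); apply/eqP; rewrite eqn_leq yx andbT.
    exact: ymax.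
  case/andP=> jC /eqP[_ eC]; case/set0Pn: C0 => k kC.
  have : k \in [set i] by rewrite eC !inE kC orbT.
  have : j \in [set i] by rewrite eC !inE eqxx.
  by rewrite !inE => /eqP ji /eqP ki; move: jC; rewrite ji -ki kC.
move=> /eqP[-> ->]; apply/andP; split; last first.
  by apply/orP; left; apply/existsP; exists y; rewrite inE setU0 eqxx.
rewrite !cards1 eqxx /=; apply/andP; split; last by apply/set0Pn; exists i; rewrite inE.
apply/dominantP => z; exists i; first by rewrite inE.
by move=> x; rewrite inE => /eqP ->; exact: ymax.
Qed.

(** * Parity of the almost coloured doors of a room *)

Section colouring.
Variables (c : T -> I) (i0 : I).

Definition almost_coloured (d : {set T} * {set I}) :=
  (i0 \in d.2) && (c @: d.1 == d.2 :\ i0).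

(** There are none or exactly two. If one door adds an order [i], the colours on [D] are distinct
    and the other door removes the point coloured [i]. If all doors remove a point, exactly two
    points of [D] share a colour, and removing either one gives a door. *)
Lemma even_doors_of_room r : room r -> c @: r.1 != r.2 ->
  ~~ odd #|[set d | almost_coloured d && adjacent d r]|.
Proof.
case: r => D C /and3P[/= _ /eqP card _] ncol.
pose S := [set d | almost_coloured d && adjacent d (D, C)].
have SP d : d \in S -> i0 \in C /\
   ((exists2 x, x \in D & d = (D :\ x, C) /\ c @: (D :\ x) = C :\ i0) \/
    (exists2 i, i \notin C & d = (D, i |: C) /\ c @: D = (i |: C) :\ i0)).
  case: d => D' C'; rewrite !inE /almost_coloured /adjacent /=.
  case/andP=> /andP[i0C /eqP col] /orP[/existsP[x]|/existsP[i]] /andP[xD /eqP[eD eC]]; subst D C'.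
    split=> //; left; exists x; first by rewrite !inE eqxx.
    by rewrite setU1K.
  (* Adding [i0] itself would mean [c @: D = C], a fully coloured room. *)
  have ne : i0 != i.
    by apply: contraNneq ncol => e; rewrite col e setU1K.
  split; first by move: i0C; rewrite !inE (negbTE ne).
  by right; exists i.
have T1 x : i0 \in C -> x \in D -> c @: (D :\ x) = C :\ i0 -> (D :\ x, C) \in S.
  move=> i0C xD col; rewrite !inE /almost_coloured /adjacent /= i0C col eqxx /=.
  by apply/orP; left; apply/existsP; exists x; rewrite !inE eqxx /= setD1K.
have T2 i : i0 \in C -> i \notin C -> c @: D = (i |: C) :\ i0 -> (D, i |: C) \in S.
  move=> i0C iC col; rewrite !inE /almost_coloured /adjacent /= !inE i0C orbT col eqxx /=.
  by apply/orP; right; apply/existsP; exists i; rewrite iC eqxx.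
suff : S = set0 \/ exists d1 d2, d1 != d2 /\ S = [set d1; d2].
  by rewrite -/S => -[->|[d1 [d2 [d12 ->]]]]; rewrite ?cards0// cards2 d12.
have [->|/set0Pn[d0 d0S]] := eqVneq S set0; first by left.
right; have [i0C _] := SP _ d0S.
have neqD (x : T) C1 C2 : x \in D -> (D :\ x, C1) != (D, C2).
  move=> xD; apply/eqP => -[/setP/(_ x)]; rewrite !inE eqxx xD.
  by [].
have [/existsP[i /andP[iC /eqP col]]|no2] :=
    boolP [exists i, (i \notin C) && (c @: D == (i |: C) :\ i0)].
  have ii0 : i != i0 by apply: contraNneq iC => ->.
  have cinj : {in D &, injective c}.
    apply/imset_injP; have := cardsD1 i0 (i |: C).
    by rewrite col !inE i0C orbT cardsU1 iC card; lia.
  have /imsetP[x xD ix] : i \in c @: D by rewrite col !inE eqxx ii0.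
  have colx : c @: (D :\ x) = C :\ i0.
    apply/eqP; rewrite eqEcard; apply/andP; split.
      apply/subsetP => j /imsetP[z]; rewrite !inE => /andP[zx zD] ->.
      have : c z \in c @: D by rewrite imset_f.
      rewrite col !inE => /andP[-> /orP[/eqP czi|->//]].
      by move: zx; rewrite (cinj z x) ?eqxx// czi.
    rewrite card_in_imset; last first.
      by apply: sub_in2 cinj => z /setD1P[].
    by have := cardsD1 i0 C; have := cardsD1 x D; rewrite i0C xD card; lia.
  exists (D :\ x, C), (D, i |: C); split; first exact: neqD.
  apply/setP => d; rewrite in_set2; apply/idP/idP; last first.
    by case/orP=> /eqP ->; [exact: T1|exact: T2].
  case/SP=> [_ [[z zD [-> colz]]|[i' i'C [-> coli']]]].
    have [->|zx] := eqVneq z x; first by rewrite eqxx.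
    have : i \in c @: (D :\ z) by apply/imsetP; exists x; rewrite // !inE eq_sym zx.
    by rewrite colz !inE (negbTE iC) andbF.
  have : i' \in (i |: C) :\ i0.
    by rewrite -col coli' !inE eqxx andbT; apply: contraNneq i'C => ->.
  by rewrite !inE (negbTE i'C) orbF => /andP[_ /eqP ->]; rewrite eqxx orbT.
have {no2} no2 i : i \notin C -> c @: D = (i |: C) :\ i0 -> False.
  by move=> iC col; move/existsP: no2; apply; exists i; rewrite iC col eqxx.
have [x xD colx] : exists2 x, x \in D & c @: (D :\ x) = C :\ i0.
  have [_ [[x xD [_ colx]]|[i iC [_ col]]]] := SP _ d0S; first by exists x.
  by have := no2 _ iC col.
have colD : c @: D = c x |: (C :\ i0) by rewrite -(setD1K xD) imsetU1 colx.
have cx0 : c x != i0.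
  by apply: contraNneq ncol => e; rewrite colD e setD1K.
have cxC : c x \in C.
  rewrite -[_ \in _]negbK; apply/negP => cxC; apply: (no2 _ cxC).
  rewrite colD; apply/setP => j; rewrite !inE.
  by case: (eqVneq j (c x)) => [->|]; rewrite ?cx0.
have /imsetP[x' x'D cxx'] : c x \in c @: (D :\ x) by rewrite colx !inE cx0.
have cinj : {in D :\ x &, injective c}.
  apply/imset_injP; rewrite colx.
  by have := cardsD1 i0 C; have := cardsD1 x D; rewrite i0C xD card; lia.
have [x'x x'D'] : x' != x /\ x' \in D by move: x'D; rewrite !inE => /andP.
have colx' : c @: (D :\ x') = C :\ i0.
  rewrite -colx; apply/setP => j; apply/imsetP/imsetP => -[z].
    rewrite !inE => /andP[zx' zD] ->; have [->|zx] := eqVneq z x.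
      by exists x'.
    by exists z; rewrite // !inE zx.
  rewrite !inE => /andP[zx zD] ->; have [->|zx'] := eqVneq z x'.
    by exists x; rewrite // !inE eq_sym x'x.
  by exists z; rewrite // !inE zx'.
exists (D :\ x, C), (D :\ x', C); split.
  apply/eqP => -[/setP/(_ x)]; rewrite !inE eqxx xD andbT /=.
  by rewrite eq_sym x'x.
apply/setP => d; rewrite in_set2; apply/idP/idP; last first.
  by case/orP=> /eqP ->; exact: T1.
case/SP=> [_ [[z zD [-> colz]]|[i iC [_ col]]]]; last by have := no2 _ iC col.
have [->|zx] := eqVneq z x; first by rewrite eqxx.
have [->|zx'] := eqVneq z x'; first by rewrite eqxx orbT.
have : c z \in c @: (D :\ z) by rewrite colz -colx imset_f// !inE zx.
case/imsetP => y; rewrite !inE => /andP[yz yD] czy.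
have [yx|yx] := eqVneq y x.
  by move: zx'; rewrite (cinj z x') ?eqxx// ?inE ?zx// czy yx.
by move: yz; rewrite (cinj z y) ?eqxx// ?inE ?zx ?yx.
Qed.

(* Scarf's lemma. Double counting, modulo 2, of the adjacent pairs of a room
   and an almost coloured door: every such door has two rooms, except the only
   one without points, and the rooms that are not fully coloured have an even
   number of such doors. *)
Lemma exists_coloured_room (t : T) :
  exists D C, [/\ C != set0, dominant D C & c @: D = C].
Proof.
suff /existsP[[D C] /andP[/and3P[dom _ C0] /eqP col]] :
    [exists r, room r && (c @: r.1 == r.2)] by exists D, C.
apply: contraT => none.
pose e := fun d r => [&& almost_coloured d, room r & adjacent d r].
have : \sum_d \sum_(r | e d r) 1 = \sum_r \sum_(d | e d r) 1.
  by rewrite (exchange_big_dep predT).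
have evenR : ~~ odd (\sum_r \sum_(d | e d r) 1).
  rewrite (big_morph odd oddD (erefl _ : odd 0 = false)) big1// => r _.
  have [rr|rr] := boolP (room r); last first.
    by rewrite big_pred0// => d; rewrite /e (negbTE rr) andbF.
  rewrite sum1_card -[RHS](negbTE (@even_doors_of_room r rr _)).
    by congr odd; apply: eq_card => d; rewrite !inE /e rr.
  by apply: contraNN none => col; apply/existsP; exists r; rewrite rr.
suff : odd (\sum_d \sum_(r | e d r) 1) by move=> + E; rewrite E (negbTE evenR).
rewrite (bigD1 (set0, [set i0]))//= oddD.
have -> : \sum_(r | e (set0, [set i0]) r) 1 = 1.
  rewrite sum1_card -(card_rooms_of_outside_door i0 t); apply: eq_card => r.
  by rewrite !inE /e /almost_coloured /= imset0 !inE eqxx setDv eqxx.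
rewrite /= (big_morph odd oddD (erefl _ : odd 0 = false)) big1// => -[D C] neq.
have [/andP[i0C /eqP col]|nd] := boolP (almost_coloured (D, C)); last first.
  by rewrite big_pred0// => r; rewrite /e (negbTE nd).
have [/existsP[r /andP[rr ra]]|nr] := boolP [exists r, room r && adjacent (D, C) r]; last first.
  rewrite big_pred0// => r; apply/negP => /and3P[_ rr ra].
  by move/existsP: nr; apply; exists r; rewrite rr.
have D0 : D != set0.
  apply: contraNneq neq => D0; rewrite D0 xpair_eqE eqxx /=.
  by move: col; rewrite /= D0 imset0 -{2}(setD1K (i0C : i0 \in C)) => <-; rewrite setU0.
(* [almost_coloured] says nothing about dominance; the door inherits it from an adjacent room, since
   removing a point or adding an order preserves it. *)
have [domDC cardC] : dominant D C /\ #|C| = #|D|.+1.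
  case: r rr ra => D' C' /and3P[/= /dominantP dom /eqP card _].
  case/orP=> [/existsP[x]|/existsP[i]] /= /andP[xD /eqP[eD eC]].
    subst D' C'; split; last by rewrite -card cardsU1 xD.
    apply/dominantP => y; have [i iC Hi] := dom y; exists i => // z zD.
    by apply: Hi; rewrite inE zD orbT.
  subst D' C; split; last by rewrite cardsU1 xD card.
  apply/dominantP => y; have [j jC Hj] := dom y; exists j => //.
  by rewrite inE jC orbT.
case/set0Pn: D0 => x0 x0D.
have /fin_all_exists[m mP] : forall i, exists x, x \in D /\
    forall z, z \in D -> key i x <= key i z.
  by move=> i; case: (@arg_minnP _ x0 (mem D) (key i) x0D) => x xD Hx; exists x.
rewrite sum1_card -[RHS]/(odd 2) -(card_rooms_of_door domDC cardC (fun i => (mP i).1)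
  (fun i => (mP i).2)); congr odd; apply: eq_card => q.
by rewrite !inE /e /almost_coloured /= i0C col eqxx.
Qed.

End colouring.
End dominance.

From mathcomp Require Import all_order all_algebra.
From mathcomp Require Import all_classical all_reals all_analysis.
From mathcomp Require Import measurable_realfun.
From mathcomp Require Import ring lra.

Import Order.TTheory GRing.Theory Num.Theory.
Import numFieldNormedType.Exports.

Local Open Scope classical_set_scope.
Local Open Scope ring_scope.

(** * Brouwer's theorem on a simplex *)

(** Tychonoff's theorem on the cube of functions from [T] to [[-K, K]]. A cluster point is given
    rather than a subsequence because [T] may be [R], where pointwise convergent subsequences need
    not exist; indices are chosen for finitely many points at a time. *)
Lemma pointwise_cluster (R : realType) (T : eqType) (K : R) (w : nat -> T -> R) :
  (forall k t, `|w k t| <= K) ->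
  exists w0 : T -> R, forall (s : seq T) (e : R) (m : nat), 0 < e ->
    exists2 k, (m <= k)%N & forall t, t \in s -> `|w k t - w0 t| < e.
Proof.
move=> wK.
pose P : topologicalType := {ptws T -> R}.
have [|w0 [_ clw]] := @tychonoff T (fun=> R) (fun=> [set` `[- K, K]])
    (fun=> @segment_compact R (- K) K) (w @ \oo) (fmap_proper_filter w _).
  by exists 0%N => // k _ t /=; rewrite in_itv/= -ler_norml.
exists w0 => s e m e0.
have nb : @nbhs P P w0 [set f : T -> R | forall t, t \in s -> `|f t - w0 t| < e].
  elim: s => [|t s IH]; first by apply: filterS filterT => f _ t; rewrite in_nil.
  have : \forall f \near (w0 : P), `|f t - w0 t| < e.
    have pt : (fun f : P => f t) @ nbhs (w0 : P) --> (w0 t : R).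
      exact: (@proj_continuous T (fun=> R) t w0).
    have /cvgrPdist_lt/(_ _ e0) := pt.
    by apply: filterS => f /=; rewrite distrC.
  move=> /(filterI IH); apply: filterS => f [H1 H2] t'; rewrite inE.
  by case/orP=> [/eqP ->|/H1].
have tail : (w @ \oo) [set f : T -> R | exists2 k, (m <= k)%N & f = w k].
  by exists m => // k /= mk; exists k.
by have [f [[k mk ->] H]] := clw _ _ tail nb; exists k.
Qed.

Lemma cvg_dist_harmonic (R : realType) (u : nat -> R) (l : R) :
  (forall k, `|u k - l| <= k.+1%:R^-1) -> u k @[k --> \oo] --> l.
Proof.
move=> H; apply/cvgrPdist_le => e e0; near=> k.
rewrite distrC; apply: le_trans (H k) _; apply: ltW; near: k.
exact: near_infty_natSinv_lt (PosNum e0).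
Unshelve. all: by end_near. Qed.

Section brouwer.
Context {R : realType} (n : nat).
Local Notation vec := ('I_n.+1 -> R).

Definition simplex (x : vec) := (forall i, 0 <= x i) /\ \sum_i x i = 1.

Variable f : vec -> vec.
Hypothesis f_simplex : forall x, simplex x -> simplex (f x).

Lemma simplex_le1 x i : simplex x -> x i <= 1.
Proof.
by move=> [x0 <-]; rewrite (bigD1 i)//= lerDl; apply: sumr_ge0.
Qed.

(* A point of the grid of mesh [1 / N] is coloured by a coordinate which [f]
   does not decrease, so that no boundary condition on colours is needed: the
   coordinates absent from the coloured cell are small on it. *)
Lemma approx_fixed_point (N : nat) : (0 < N)%N -> exists2 x, simplex x &
  forall i, exists2 z, simplex z & (forall j, `|z j - x j| <= n.+1%:R / N%:R) /\
    z i - n.+1%:R / N%:R <= f z i.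
Proof.
move=> N0; have NR : 0 < N%:R :> R by rewrite ltr0n.
pose total (g : {ffun 'I_n.+1 -> 'I_N.+1}) := (\sum_i (g i : nat) == N)%N.
pose T : finType := {g : {ffun 'I_n.+1 -> 'I_N.+1} | total g}.
have TE (g : T) : (\sum_i (sval g i : nat) = N)%N by exact/eqP/(valP g).
(* The [i]-th coordinates are compared first; ties are broken by the rank, which is less than
   [#|T|], so that distinct points get distinct keys. *)
pose key (i : 'I_n.+1) (g : T) : nat := (sval g i * #|T| + enum_rank g)%N.
have key_inj i : injective (key i).
  move=> g h; rewrite /key => /(congr1 (modn^~ #|T|)).
  by rewrite !modnMDl !modn_small// => /ord_inj/enum_rank_inj.
have key_le i g h : (key i g <= key i h)%N -> (sval g i <= sval h i)%N.
  rewrite /key => H; rewrite leqNgt; apply/negP => lt.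
  have er : (enum_rank h < #|T|)%N := ltn_ord _.
  have : ((sval h i).+1 * #|T| <= sval g i * #|T|)%N by rewrite leq_mul2r lt orbT.
  rewrite mulSn leqNgt => /negP; apply.
  by rewrite addnC; move: H er; set a := (sval g i * _)%N; set b := (sval h i * _)%N; lia.
pose pt (g : T) : vec := fun i => (sval g i)%:R / N%:R.
have pt_simplex g : simplex (pt g).
  split=> [i|]; first by rewrite /pt divr_ge0.
  by rewrite /pt -mulr_suml -natr_sum TE divff// gt_eqF.
have /fin_all_exists[c cP] : forall g, exists i, pt g i <= f (pt g) i.
  move=> g; apply/existsP; apply: contraT; rewrite negb_exists => /forallP H.
  have [_ e] := pt_simplex g; have [_ e'] := f_simplex (pt_simplex g).
  suff : \sum_i f (pt g) i < \sum_i pt g i by rewrite e e' ltxx.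
  apply: ltr_sum => [|i _]; last by rewrite ltNge H.
  by apply/hasP; exists ord0; rewrite // mem_index_enum.
have t0sum : total [ffun i => if i == ord0 then ord_max else ord0].
  rewrite /total (bigD1 ord0)//= ffunE eqxx big1 ?addn0//= => i i0.
  by rewrite ffunE (negbTE i0).
pose t0 : T := exist total _ t0sum.
have [D [C [C0 /dominantP dom col]]] := exists_coloured_room key_inj c ord0 t0.
have colC i : i \in C -> exists2 g, g \in D & c g = i.
  by rewrite -col => /imsetP[g gD ->]; exists g.
have [i1 i1C] := set0Pn _ C0; have [g1 g1D _] := colC _ i1C.
have /fin_all_exists[mg mgP] : forall i, exists g, g \in D /\
    forall h, h \in D -> (sval g i <= sval h i)%N.
  move=> i; case: (@arg_minnP _ g1 (mem D) (fun g => sval g i : nat) g1D) => g gD Hg.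
  by exists g.
pose m i : nat := sval (mg i) i.
(* Otherwise the grid point [y], at least [m i + 1] for [i] in [C] and 0 elsewhere, would lie above
   a point of [D] in every order of [C]. The slack is given to [i1], so that its coordinates sum to
   [N]. *)
have sumC : (N < \sum_(i in C) (m i).+1)%N.
  rewrite ltnNge; apply/negP => le.
  pose y i : nat := ((if i \in C then (m i).+1 else 0) +
    (if i == i1 then N - \sum_(i in C) (m i).+1 else 0))%N.
  have ysum : (\sum_i y i = N)%N.
    rewrite big_split /= -big_mkcond /= -(big_mkcond (fun i => i == i1)) /= big_pred1_eq.
    by rewrite subnKC.
  have yN i : (y i <= N)%N by rewrite -ysum (bigD1 i)//= leq_addr.
  have yTP : total [ffun i => inord (y i)].
    rewrite /total -[X in _ == X]ysum; apply/eqP; apply: eq_bigr => i _.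
    by rewrite ffunE inordK// ltnS.
  pose yT : T := exist total _ yTP.
  have [i iC Hi] := dom yT; have [mD _] := mgP i.
  have := key_le _ _ _ (Hi _ mD); rewrite /= ffunE inordK ?ltnS// /y iC -/(m i).
  lia.
(* The coordinates of [g] sum to [N], and those in [C] are at least [m], whose sum over [C] exceeds
   [N - #|C|]. So the total excess, over [m] on [C] and over 0 off [C], is less than [n.+1]. *)
have close g i : g \in D ->
    if i \in C then (m i <= sval g i <= m i + n.+1)%N else (sval g i <= n.+1)%N.
  move=> gD; have mle j : (m j <= sval g j)%N by have [_] := mgP j; apply.
  have cC : (#|C| <= n.+1)%N by rewrite -[X in (_ <= X)%N]card_ord max_card.
  pose q j := (if j \in C then m j else 0)%N.
  have qle j : (q j <= sval g j)%N by rewrite /q; case: ifP.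
  have sumq : (N < \sum_j q j + #|C|)%N.
    rewrite -sum1_card /q -big_mkcond -big_split /=.
    by move: sumC; under eq_bigr do rewrite -addn1.
  have gq : (sval g i - q i <= n.+1)%N.
    apply: (@leq_trans (\sum_j (sval g j - q j))); first by rewrite (bigD1 i)//= leq_addr.
    by rewrite sumnB ?TE// leq_subLR (leq_trans (ltnW sumq))// leq_add2l.
  by move: gq; rewrite /q; case: ifP => iC; rewrite ?subn0// leq_subLR mle => ->.
have dist g h j : g \in D -> h \in D -> `|pt g j - pt h j| <= n.+1%:R / N%:R.
  move=> gD hD; rewrite /pt -mulrBl normrM [`|N%:R^-1|]gtr0_norm ?invr_gt0//.
  rewrite ler_pM2r ?invr_gt0// ler_distl.
  have := close g j gD; have := close h j hD.
  by case: ifP => _ H1 H2; rewrite lerBlDr -!natrD !ler_nat; lia.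
exists (pt g1); first exact: pt_simplex.
move=> i; have [iC|iC] := boolP (i \in C).
  have [g gD gi] := colC _ iC; exists (pt g); first exact: pt_simplex.
  split=> [j|]; first exact: dist.
  apply: le_trans (_ : pt g i <= _); last by rewrite -gi cP.
  by rewrite gerBl divr_ge0.
exists (pt g1); first exact: pt_simplex.
split=> [j|]; first exact: dist.
apply: (@le_trans _ _ 0); last by have [+ _] := f_simplex (pt_simplex g1); apply.
rewrite subr_le0 /pt ler_pM2r ?invr_gt0// ler_nat.
by have := close g1 i g1D; rewrite (negbTE iC).
Qed.

Hypothesis f_continuous : forall (u : nat -> vec) x,
  (forall k, simplex (u k)) -> simplex x ->
  (forall i, u k i @[k --> \oo] --> x i) ->
  forall i, f (u k) i @[k --> \oo] --> f x i.

(** One-sided information is enough: in the limit [x i <= f x i] for every [i], and both sides sum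
    to 1. The auxiliary points [Z] depend on [i], but for each [i] they converge to the same [x]. *)
Theorem brouwer_simplex : exists2 x, simplex x & f x =1 x.
Proof.
have /choice[X XP] : forall N, exists x, simplex x /\
  forall i, exists z, [/\ simplex z, (forall j, `|z j - x j| <= n.+1%:R / N.+1%:R) &
    z i - n.+1%:R / N.+1%:R <= f z i].
  move=> N; have [x sx H] := @approx_fixed_point N.+1 isT; exists x; split=> // i.
  by have [z sz [H1 H2]] := H i; exists z.
have [x clx] : exists x : vec, forall (s : seq 'I_n.+1) (e : R) m, 0 < e ->
    exists2 k, (m <= k)%N & forall t, t \in s -> `|X k t - x t| < e.
  apply: (@pointwise_cluster _ _ 1) => k i; have [[x0 x1] _] := XP k.
  by rewrite ger0_norm// simplex_le1.
have /choice[K KP] : forall k, exists l, (k <= l)%N /\ forall i, `|X l i - x i| <= k.+1%:R^-1.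
  move=> k; have k0 : 0 < k.+1%:R^-1 :> R by rewrite invr_gt0.
  have [l kl H] := clx (enum 'I_n.+1) _ k k0.
  by exists l; split=> // i; apply/ltW/H; rewrite mem_enum.
have cvX i : X (K k) i @[k --> \oo] --> x i.
  by apply: cvg_dist_harmonic => k; have [_] := KP k; apply.
have cvh : n.+1%:R / (K k).+1%:R @[k --> \oo] --> (0 : R).
  apply: (@squeeze_cvgr _ _ _ _ (fun=> 0) (fun k => n.+1%:R * k.+1%:R^-1)).
  - near=> k; rewrite divr_ge0//= ler_pM2l// lef_pV2 ?posrE// ler_nat ltnS.
    by have [] := KP k.
  - exact: cvg_cst.
  - rewrite -[X in _ --> X](mulr0 n.+1%:R); apply: cvgM; first exact: cvg_cst.
    by apply: cvg_dist_harmonic => k; rewrite subr0 ger0_norm.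
have sx : simplex x.
  split=> [i|].
    apply: (ler_cvg_to (cvg_cst 0) (cvX i)).
    by near=> k; have [[+ _] _] := XP (K k); apply.
  have : \sum_i X (K k) i @[k --> \oo] --> \sum_i x i.
    by apply: cvg_big => // ; exact: add_continuous.
  under eq_fun => k do rewrite (XP (K k)).1.2.
  by move=> /cvg_lim <-//; rewrite lim_cst.
have le i : x i <= f x i.
  have /choice[Z ZP] := fun k => (XP (K k)).2 i.
  have cvZ j : Z k j @[k --> \oo] --> x j.
    have -> : (fun k => Z k j) = (fun k => Z k j - X (K k) j) \+ (fun k => X (K k) j).
      by apply/funext => k /=; rewrite subrK.
    rewrite -[x j]add0r; apply: cvgD; last exact: cvX.
    apply: norm_cvg0; apply: squeeze_cvgr (cvg_cst 0) cvh.
    by near=> k; rewrite normr_ge0; have [_ + _] := ZP k; apply.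
  have cvf : f (Z k) i @[k --> \oo] --> f x i.
    by apply: f_continuous => // k; have [] := ZP k.
  have cvd : Z k i - n.+1%:R / (K k).+1%:R @[k --> \oo] --> x i.
    by rewrite -[x i]subr0; apply: cvgB.
  apply: (ler_cvg_to cvd cvf).
  by near=> k; have [] := ZP k.
exists x => // i; apply/eqP; rewrite eq_sym -subr_eq0.
have [[_ fs] [_ xs]] := (f_simplex sx, sx).
have : \sum_i (f x i - x i) = 0 by rewrite sumrB fs xs subrr.
move/eqP; rewrite psumr_eq0 => [/allP/(_ i)|j _]; last by rewrite subr_ge0.
by rewrite mem_index_enum => /(_ isT)/=; rewrite -oppr_eq0 opprB.
Unshelve. all: by end_near. Qed.

End brouwer.

(** * Fixed points on nondecreasing profiles *)

Section clamp.
Context {R : realType}.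
Implicit Types (s t : R).

(** The retraction of the line onto [[0, 1]]. It serves as the ramp of polygonal functions and
    extends [response] by constants outside the interval. *)
Definition clamp01 t : R := Num.min 1 (Num.max 0 t).

Lemma clamp01_id t : 0 <= t -> t <= 1 -> clamp01 t = t.
Proof. by move=> t0 t1; rewrite /clamp01 max_r// min_r. Qed.

Lemma clamp01_le0 t : t <= 0 -> clamp01 t = 0.
Proof. by move=> t0; rewrite /clamp01 max_l// min_r. Qed.

Lemma clamp01_ge1 t : 1 <= t -> clamp01 t = 1.
Proof. by move=> t1; rewrite /clamp01 min_l// le_max t1 orbT. Qed.

Lemma clamp01_itv t : 0 <= clamp01 t /\ clamp01 t <= 1.
Proof.
by split; [rewrite /clamp01 le_min ler01 le_max lexx|rewrite /clamp01 ge_min lexx].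
Qed.

Lemma clamp01_increment s t : s <= t -> 0 <= clamp01 t - clamp01 s <= t - s.
Proof.
move=> st; have [t0|/ltW t0] := leP t 0.
  by rewrite !clamp01_le0 ?subrr ?lexx ?subr_ge0// (le_trans st).
have [s1|/ltW s1] := leP 1 s.
  by rewrite !clamp01_ge1 ?subrr ?lexx ?subr_ge0// (le_trans s1).
have -> : clamp01 s = Num.max 0 s by rewrite /clamp01 min_r// ge_max ler01.
have -> : clamp01 t = Num.min 1 t by rewrite /clamp01 max_r.
by case: (leP 0 s) => ?; case: (leP 1 t) => ?; apply/andP; split; lra.
Qed.

End clamp.

Section monotone_profiles.
Context {R : realType} (rho : R).
Implicit Types (w y : R -> R) (s t : R).

(** Profiles live on the whole line, constant on either side of [[0, 1]], so that continuity and
    primitives need no one-sided version at the endpoints. *)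
Definition profile w := [/\ forall t, t <= 0 -> w t = 0,
  forall t, 1 <= t -> w t = rho,
  {homo w : s t / s <= t} & continuous w].

Definition increments_le (M : R) w := forall s t, s <= t -> w t - w s <= M * (t - s).

Lemma profile_itv w t : profile w -> 0 <= w t <= rho.
Proof.
move=> [w0 w1 wh _]; apply/andP; split.
  by have [/w0 ->//|/ltW/wh] := leP t 0; rewrite w0.
by have [/w1 ->|/ltW/wh] := leP 1 t; rewrite ?(w1 1).
Qed.

Lemma lipschitz_continuous (M : R) w :
  (forall s t, `|w s - w t| <= M * `|s - t|) -> continuous w.
Proof.
move=> H t; apply/cvgrPdist_lt => e e0; have M0 : 0 < `|M| + 1 by rewrite ltr_wpDl.
near=> s; apply: le_lt_trans (H t s) _.
apply: (@le_lt_trans _ _ ((`|M| + 1) * `|t - s|)).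
  by rewrite ler_wpM2r// (le_trans (ler_norm _))// lerDl.
rewrite mulrC -ltr_pdivlMr//; near: s.
by apply: cvgr_dist_lt => //; rewrite divr_gt0.
Unshelve. all: by end_near. Qed.

Lemma increments_le_continuous (M : R) w : {homo w : s t / s <= t} ->
  increments_le M w -> continuous w.
Proof.
move=> wh wM; apply: (@lipschitz_continuous M) => s t.
wlog st : s t / s <= t.
  move=> H; have [/H//|/ltW/H] := leP s t.
  by rewrite distrC [in X in _ <= X]distrC.
by rewrite distrC [in X in _ <= X]distrC !ger0_norm ?subr_ge0//; [exact: wM|exact: wh].
Qed.

Section polygonal.
Variable n : nat.
Implicit Types (x : 'I_n.+1 -> R) (i : 'I_n.+1).

Let clamp_homo : {homo (@clamp01 R) : z z' / z <= z'}.
Proof. by move=> z z' /clamp01_increment/andP[]; rewrite subr_ge0. Qed.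

Let clamp_continuous : continuous (@clamp01 R).
Proof.
apply: (increments_le_continuous (M := 1) clamp_homo) => s t st.
by rewrite mul1r; have /andP[] := clamp01_increment st.
Qed.

(** The barycentric coordinate [x i] is the share of the rise [rho] gained on the [i]-th of [n.+1]
    equal cells; the clamped term is the ramp from 0 to 1 across that cell. *)
Definition polygonal x t := rho * \sum_i x i * clamp01 (n.+1%:R * t - i%:R).

Let node (j : nat) : R := j%:R / n.+1%:R.

Let nodeK j : n.+1%:R * node j = j%:R.
Proof. by rewrite /node mulrC divfK// pnatr_eq0. Qed.

Let node_itv t : 0 <= t -> t <= 1 -> exists2 j, (j <= n)%N & node j <= t <= node j.+1.
Proof.
move=> t0 t1; have n0 : 0 < n.+1%:R :> R by [].
have [t1'|t1'] := ltP t 1; last first.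
  exists n => //; rewrite /node divff// t1 andbT (le_trans _ t1')//.
  by rewrite ler_pdivrMr// mul1r ler_nat.
have := @truncn_itv _ (t * n.+1%:R) (mulr_ge0 t0 (ltW n0)).
set j := Num.trunc _ => /andP[jt tj]; exists j.
  have : j%:R < n.+1%:R :> R by apply: le_lt_trans jt _; rewrite gtr_pMl.
  by rewrite ltr_nat.
by rewrite /node ler_pdivrMr// jt ler_pdivlMr// ltW.
Qed.

Lemma polygonal_profile x : 0 <= rho -> simplex x -> profile (polygonal x).
Proof.
move=> rho0 [x0 x1]; split=> [t t0|t t1|s t st|].
- rewrite /polygonal big1 ?mulr0// => i _; rewrite clamp01_le0 ?mulr0//.
  have := ler0n R i; have : n.+1%:R * t <= 0 by rewrite mulr_ge0_le0.
  lra.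
- rewrite /polygonal (eq_bigr x) ?x1 ?mulr1// => i _.
  rewrite clamp01_ge1 ?mulr1//; have : i%:R + 1 <= n.+1%:R :> R by rewrite natr1 ler_nat.
  have : n.+1%:R <= n.+1%:R * t by rewrite ler_peMr.
  lra.
- rewrite /polygonal ler_wpM2l//; apply: ler_sum => i _.
  by rewrite ler_wpM2l//; apply: clamp_homo; rewrite lerD2r ler_wpM2l.
- move=> t; apply: cvgM; first exact: cvg_cst.
  apply: cvg_big => [|i _]; first exact: add_continuous.
  apply: cvgM; first exact: cvg_cst.
  apply: (@cvg_comp _ _ _ (fun s => n.+1%:R * s - i%:R) clamp01 _
    (nbhs (n.+1%:R * t - i%:R))); last exact: clamp_continuous.
  by apply: cvgB; [apply: cvgM; [exact: cvg_cst|exact: cvg_id]|exact: cvg_cst].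
Qed.

Lemma polygonal_dist x (y : 'I_n.+1 -> R) t : 0 <= rho ->
  `|polygonal x t - polygonal y t| <= rho * \sum_i `|x i - y i|.
Proof.
move=> rho0; rewrite /polygonal -mulrBr normrM ger0_norm// ler_wpM2l//.
rewrite -sumrB (le_trans (ler_norm_sum _ _ _))//; apply: ler_sum => i _.
rewrite -mulrBl normrM ler_piMr//; have [c0 c1] := clamp01_itv (n.+1%:R * t - i%:R).
by rewrite ger0_norm.
Qed.

Lemma polygonal_node x (j : nat) :
  polygonal x (node j) = rho * \sum_(i < n.+1 | (i < j)%N) x i.
Proof.
rewrite /polygonal; congr (_ * _); rewrite [RHS]big_mkcond; apply: eq_bigr => i _.
rewrite nodeK; case: ifPn => ij.
  by rewrite clamp01_ge1 ?mulr1// lerBrDr addrC natr1 ler_nat.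
by rewrite clamp01_le0 ?mulr0// subr_le0 ler_nat leqNgt.
Qed.

Let sum_increments w (j : nat) : (j <= n.+1)%N -> w (node 0) = 0 ->
  \sum_(i < n.+1 | (i < j)%N) (w (node i.+1) - w (node i)) = w (node j).
Proof.
move=> jn w0.
rewrite -(big_ord_widen _ (fun k => w (node k.+1) - w (node k)) jn).
rewrite -(big_mkord predT (fun k => w (node k.+1) - w (node k))).
by rewrite (telescope_sumr (w \o node))//= w0 subr0.
Qed.

Variables (M : R) (N : (R -> R) -> R -> R).
Hypothesis rho_gt0 : 0 < rho.
Hypothesis N_profile : forall w, profile w -> profile (N w) /\ increments_le M (N w).
Hypothesis N_continuous : forall (u : nat -> R -> R) w,
  (forall k, profile (u k)) -> profile w ->
  (forall e : R, 0 < e -> \forall k \near \oo, forall t, `|u k t - w t| <= e) ->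
  forall t, N (u k) t @[k --> \oo] --> N w t.

(** Brouwer's theorem is applied to the map sending [x] to the cell increments of [N (polygonal x)],
    divided by [rho]. At a fixed point the two functions agree at all nodes. On a cell both are
    nondecreasing between the same end values, which differ by at most [M / n.+1]. *)
Lemma approx_monotone_fixed_point :
  exists2 w, profile w & forall t, `|w t - N w t| <= M / n.+1%:R.
Proof.
have rho0 := ltW rho_gt0; have rhoN0 : rho != 0 by rewrite gt_eqF.
have n0 : 0 < n.+1%:R :> R by [].
pose f x i := (N (polygonal x) (node i.+1) - N (polygonal x) (node i)) / rho.
have node0 : node 0 = 0 by rewrite /node mul0r.
have noden : node n.+1 = 1 by rewrite /node divff// gt_eqF.
have node_le j : node j <= node j.+1 by rewrite ler_pM2r ?invr_gt0// ler_nat.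
have sf x j : simplex x -> (j <= n.+1)%N ->
    rho * \sum_(i < n.+1 | (i < j)%N) f x i = N (polygonal x) (node j).
  move=> sx jn; have [[N0 _ _ _] _] := N_profile (polygonal_profile rho0 sx).
  rewrite -(sum_increments jn) ?node0 ?N0// mulr_sumr; apply: eq_bigr => i _.
  by rewrite /f mulrC divfK.
have f_simplex x : simplex x -> simplex (f x).
  move=> sx; have [[_ N1 Nh _] _] := N_profile (polygonal_profile rho0 sx).
  split=> [i|].
    by rewrite /f divr_ge0// subr_ge0; exact: Nh.
  apply: (mulfI rhoN0); rewrite mulr1 -[RHS](N1 1)// -noden -sf//.
  by congr (_ * _); apply: eq_bigl => i; rewrite ltn_ord.
have f_cont (u : nat -> 'I_n.+1 -> R) x : (forall k, simplex (u k)) -> simplex x ->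
    (forall i, u k i @[k --> \oo] --> x i) ->
    forall i, f (u k) i @[k --> \oo] --> f x i.
  move=> su sx ux i.
  have H t : N (polygonal (u k)) t @[k --> \oo] --> N (polygonal x) t.
    apply: N_continuous => [k||e e0]; try exact: polygonal_profile.
    have : rho * \sum_i `|u k i - x i| @[k --> \oo] --> rho * \sum_(i < n.+1) 0.
      apply: cvgM; first exact: cvg_cst.
      apply: cvg_big => [|j _]; first exact: add_continuous.
      rewrite -[X in _ --> X](@normr0 _ R) -(subrr (x j)).
      by apply: cvg_norm; apply: cvgB; [exact: ux|exact: cvg_cst].
    rewrite big1// mulr0 => /cvgrPdist_le/(_ _ e0); apply: filterS => k.
    rewrite sub0r normrN => /(le_trans (ler_norm _)) le t'.
    exact: le_trans (polygonal_dist _ _ _ rho0) le.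
  by apply: cvgM; [apply: cvgB|exact: cvg_cst].
have [x sx fx] := brouwer_simplex f_simplex f_cont.
have px := polygonal_profile rho0 sx; have [pN NM] := N_profile px.
exists (polygonal x) => // t.
have eqn j : (j <= n.+1)%N -> polygonal x (node j) = N (polygonal x) (node j).
  by move=> jn; rewrite polygonal_node -sf//; congr (_ * _); apply: eq_bigr => i _.
have M0 : 0 <= M.
  have [_ N1 _ _] := pN; have [N0 _ _ _] := pN.
  by have := NM 0 1 ler01; rewrite (N0 0)// (N1 1)// !subr0 mulr1; apply: le_trans.
have [p0 p1 ph _] := px; have [N0 N1 Nh _] := pN.
have [t0|/ltW t0] := leP t 0; first by rewrite p0// N0// subrr normr0 divr_ge0.
have [t1|/ltW t1] := leP 1 t; first by rewrite p1// N1// subrr normr0 divr_ge0.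
have [j jn /andP[jt tj]] := node_itv t0 t1.
have step : N (polygonal x) (node j.+1) - N (polygonal x) (node j) <= M / n.+1%:R.
  apply: le_trans (NM _ _ (node_le j)) _.
  by rewrite /node -mulrBl -natr1 addrAC subrr add0r mul1r.
have := ph _ _ jt; have := ph _ _ tj; have := Nh _ _ jt; have := Nh _ _ tj.
rewrite (eqn j (leqW jn)) (eqn j.+1 jn) => h1 h2 h3 h4; 
move: step h1 h2 h3 h4; move: (M / _) (N _ t) (N _ (node j.+1)) (N _ (node j)) (polygonal x t).
by move=> C a b c d *; rewrite ler_norml; apply/andP; split; lra.
Qed.

End polygonal.

Section fixed_point.
Variables (M : R) (N : (R -> R) -> R -> R).
Hypothesis rho_gt0 : 0 < rho.
Hypothesis N_profile : forall w, profile w -> profile (N w) /\ increments_le M (N w).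
Hypothesis N_continuous : forall (u : nat -> R -> R) w,
  (forall k, profile (u k)) -> profile w ->
  (forall e : R, 0 < e -> \forall k \near \oo, forall t, `|u k t - w t| <= e) ->
  forall t, N (u k) t @[k --> \oo] --> N w t.

(** The cluster point [y] is taken for the images [N (w n)], not for [w n], because the images share
    the increment bound [M]; hence [y] is a profile and approximation by images is uniform. The
    nearby [w (K k)] then also tend uniformly to [y], so their images tend both to [y] and to
    [N y]. *)
Theorem monotone_fixed_point : exists2 w, profile w & N w =1 w.
Proof.
have /choice[w wP] : forall n, exists w, profile w /\
    forall t, `|w t - N w t| <= M / n.+1%:R.
  move=> n; have [w pw H] := approx_monotone_fixed_point n rho_gt0 N_profile N_continuous.
  by exists w.
have pw n : profile (w n) by have [] := wP n.
have pN n : profile (N (w n)) by have [] := N_profile (pw n).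
have NM n : increments_le M (N (w n)) by have [] := N_profile (pw n).
have [y cly] : exists y : R -> R, forall (s : seq R) (e : R) m, 0 < e ->
    exists2 k, (m <= k)%N & forall t, t \in s -> `|N (w k) t - y t| < e.
  apply: (@pointwise_cluster _ _ rho) => k t.
  by have /andP[? ?] := profile_itv t (pN k); rewrite ger0_norm.
have M0 : 0 <= M.
  have [N0 N1 _ _] := pN 0%N.
  by have := NM 0%N 0 1 ler01; rewrite (N0 0)// (N1 1)// !subr0 mulr1; apply: le_trans (ltW rho_gt0).
have yM : increments_le M y.
  move=> s t st; apply/ler_addgt0Pr => e e0.
  have [|k _ H] := cly [:: s; t] (e / 2) 0%N; first by rewrite divr_gt0.
  have := H s; have := H t; rewrite !inE !eqxx orbT => /(_ isT) H1 /(_ isT) H2.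
  by have := NM k _ _ st; move: H1 H2; rewrite !ltr_norml; lra.
have py : profile y.
  have yh : {homo y : s t / s <= t}.
    move=> s t st; apply/ler_addgt0Pr => e e0.
    have [|k _ H] := cly [:: s; t] (e / 2) 0%N; first by rewrite divr_gt0.
    have := H s; have := H t; rewrite !inE !eqxx orbT => /(_ isT) H1 /(_ isT) H2.
    have [_ _ Nh _] := pN k.
    by have := Nh _ _ st; move: H1 H2; rewrite !ltr_norml; lra.
  have yE t c : (forall k, N (w k) t = c) -> y t = c.
    move=> E; apply/eqP; rewrite -subr_eq0 -normr_eq0; apply/eqP/le_anti.
    rewrite normr_ge0 andbT; apply/ler_addgt0Pr => e e0; rewrite add0r.
    have [k _ H] := cly [:: t] e 0%N e0; rewrite distrC -(E k).
    by apply/ltW/H; rewrite inE.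
  split=> [t t0|t t1||]; last exact: increments_le_continuous yM.
  - by apply: yE => k; have [+ _ _ _] := pN k; apply.
  - by apply: yE => k; have [_ + _ _] := pN k; apply.
  - exact: yh.
have [_ _ yh _] := py.
(* Both functions are nondecreasing, so closeness within [1 / k.+1] at the nodes of a grid extends
   to the cells, at the cost of the rise of [y] on one cell, at most [M / k.+1]. *)
have close k : exists l, (k <= l)%N /\ forall t, `|N (w l) t - y t| <= (M + 1) / k.+1%:R.
  have k0 : 0 < k.+1%:R^-1 :> R by rewrite invr_gt0.
  have [l kl H] := cly [seq j%:R / k.+1%:R | j <- iota 0 k.+2] _ k k0.
  exists l; split=> // t; have [N0 N1 Nh _] := pN l; have [y0 y1 _ _] := py.
  have C0 : 0 <= (M + 1) / k.+1%:R by rewrite divr_ge0// addr_ge0.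
  have [t0|/ltW t0] := leP t 0; first by rewrite N0// y0// subrr normr0.
  have [t1|t1] := leP 1 t; first by rewrite N1// y1// subrr normr0.
  have kR : 0 < k.+1%:R :> R by [].
  have /andP[jt tj] := @truncn_itv _ (t * k.+1%:R) (mulr_ge0 t0 (ltW kR)).
  move: jt tj; set j := Num.trunc _ => jt tj.
  have jk : (j < k.+1)%N.
    have : j%:R < k.+1%:R :> R by apply: le_lt_trans jt _; rewrite gtr_pMl.
    by rewrite ltr_nat.
  have {}H i : (i <= k.+1)%N ->
      `|N (w l) (i%:R / k.+1%:R) - y (i%:R / k.+1%:R)| < k.+1%:R^-1.
    by move=> ik; apply: H; apply/mapP; exists i; rewrite // mem_iota.
  have H1 := H _ (ltnW jk); have H2 := H _ jk.
  have jt' : j%:R / k.+1%:R <= t by rewrite ler_pdivrMr.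
  have tj' : t <= j.+1%:R / k.+1%:R by rewrite ler_pdivlMr// ltW.
  have := yM _ _ (le_trans jt' tj').
  have -> : j.+1%:R / k.+1%:R - j%:R / k.+1%:R = k.+1%:R^-1 :> R.
    by rewrite -mulrBl -natr1 addrAC subrr add0r mul1r.
  have := yh _ _ jt'; have := yh _ _ tj'; have := Nh _ _ jt'; have := Nh _ _ tj'.
  move: H1 H2; rewrite mulrDl mul1r !ltr_norml ler_norml.
  move: (N _ (j%:R / _)) (N _ (j.+1%:R / _)) (N _ t) (y (j%:R / _)) (y (j.+1%:R / _)) (y t).
  move: (_^-1) (M / _) => q C a b c a' b' c' /andP[? ?] /andP[? ?] *.
  by apply/andP; split; lra.
have /choice[K KP] := close.
exists y => // t.
have cvh (C : R) : C / k.+1%:R @[k --> \oo] --> (0 : R).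
  rewrite -[X in _ --> X](mulr0 C); apply: cvgM; first exact: cvg_cst.
  by apply: cvg_dist_harmonic => k; rewrite subr0 ger0_norm.
have cvN : N (w (K k)) t @[k --> \oo] --> y t.
  apply/cvgrPdist_le => e e0; have /cvgrPdist_le/(_ _ e0) := cvh (M + 1).
  apply: filterS => k; rewrite sub0r normrN => /(le_trans (ler_norm _)) le.
  by rewrite distrC; apply: le_trans le; have [_] := KP k; apply.
have cvN' : N (w (K k)) t @[k --> \oo] --> N y t.
  apply: N_continuous => // e e0; have /cvgrPdist_le/(_ _ e0) := cvh (M + (M + 1)).
  apply: filterS => k; rewrite sub0r normrN => /(le_trans (ler_norm _)) le s.
  apply: le_trans le; rewrite mulrDl.
  have [kK /(_ s)] := KP k; have [_ /(_ s)] := wP (K k).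
  have : M / (K k).+1%:R <= M / k.+1%:R.
    by rewrite ler_wpM2l// lef_pV2 ?posrE// ler_nat ltnS.
  rewrite !ler_norml; move: ((M + 1) / _) (M / k.+1%:R) (M / (K k).+1%:R) (N _ s) (w _ s) (y s).
  by move=> C C' q a b c ? /andP[? ?] /andP[? ?]; apply/andP; split; lra.
exact: (cvg_unique _ cvN' cvN).
Qed.

End fixed_point.
End monotone_profiles.

(** * Superposition of a Caratheodory function *)

Section superposition.
Context {R : realType}.
Local Notation mu := (@lebesgue_measure R).

Lemma bigcup_null (Z : nat -> set R) : (forall k, measurable (Z k)) ->
  (forall k, mu (Z k) = 0%E) -> mu (\bigcup_k Z k) = 0%E.
Proof.
move=> mZ Z0; apply/negligibleP; first exact: bigcupT_measurable.
by apply: negligible_bigcup => k; exists (Z k); split; [exact (mZ k)|exact (Z0 k)|].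
Qed.

(** For each rational level the superlevel set agrees with a Borel set off a null Borel set. [Z]
    collects these countably many null sets, and a real level is reached as the union over the
    larger rational levels. *)
Lemma lebesgue_measurable_fun_borel (D : set R) (f : R -> R) : measurable D ->
  lebesgue_measurable_fun D f ->
  exists Z, [/\ measurable Z, mu Z = 0%E & measurable_fun (D `\` Z) f].
Proof.
move=> mD mf.
have cara q : exists XZ : set R * set R, [/\ measurable XZ.1, measurable XZ.2,
    mu XZ.2 = 0%E & D `&` f @^-1` `]q, +oo[ `\` XZ.2 = XZ.1 `\` XZ.2].
  have : ((wlength (@idfun R))^*%mu).-cara.-measurable (D `&` f @^-1` `]q, +oo[).
    by apply: mf => //; exact: sub_caratheodory.
  rewrite -completed_caratheodory_measurable g_sigma_completed_algebra_genE.
  move=> [X mX [N [Z [mZ Z0 NZ]] <-]]; exists (X, Z); split => //=.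
  apply/seteqP; split=> x [XN nZ]; split=> //; last by left.
  by case: XN => // /NZ.
pose q k : R := ratr (odflt 0%Q (unpickle k)).
have /choice[XZ XZP] := fun k => cara (q k).
pose Z := \bigcup_k (XZ k).2.
have mZ : measurable Z by apply: bigcupT_measurable => k; have [] := XZP k.
exists Z; split=> //; first by apply: bigcup_null => k; have [] := XZP k.
apply: (measurability _ (RGenOInfty.measurableE R)).
move=> _ [_ [x ->] <-].
rewrite (_ : _ `&` _ = \bigcup_k ((if x < q k then (XZ k).1 else set0) `\` Z)).
  apply: bigcupT_measurable => k; apply: measurableD => //.
  by case: ifP => // _; have [] := XZP k.
apply/seteqP; split=> [t [[Dt Zt]]|t [k _]] /=.
  rewrite in_itv/= andbT => xft; have /rat_in_itvoo[p] := xft.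
  rewrite in_itv/= => /andP[xp pf]; exists (pickle p) => //; split=> //.
  rewrite /q pickleK/= xp; have [_ _ _ E] := XZP (pickle p).
  have : (D `&` f @^-1` `]q (pickle p), +oo[ `\` (XZ (pickle p)).2) t.
    split; last by move=> ZT; apply: Zt; exists (pickle p).
    by split=> //=; rewrite /q pickleK/= in_itv/= pf.
  by rewrite E => -[].
move=> [+ Zt]; case: ifP => // xq XT.
have [_ _ _ E] := XZP k.
have : ((XZ k).1 `\` (XZ k).2) t by split=> // ZT; apply: Zt; exists k.
rewrite -E => -[[Dt /=]]; rewrite !in_itv/= !andbT => qf _.
by split=> //; exact: lt_trans qf.
Qed.

Variables (V : normedModType R) (F : R -> V -> R) (K M : R).
Hypothesis F_ge0 : forall (t : R) v, t \in `[0, 1] -> 0 <= F t v.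
Hypothesis F_measurable : forall v, lebesgue_measurable_fun `[0, 1] (F ^~ v).
Hypothesis F_continuous : {ae mu, forall t : R, t \in `[0, 1] -> continuous (F t)}.
Hypothesis F_le : forall v, `|v| <= K ->
  {ae mu, forall t : R, t \in `[0, 1] -> F t v <= M}.

(** Rounding [s] down to a grid makes [F s (phi (p n s))] measurable cell by cell, and continuity of
    [phi] and [F s] gives the limit. The null sets in the hypotheses depend on the vector, but only
    the countably many vectors [v n k] occur, so their union is still null. *)
Lemma caratheodory_superposition (phi : R -> V) : 0 <= M ->
  (forall t : R, t \in `[0, 1] -> forall e : R, 0 < e -> exists2 d : R, 0 < d &
    forall s : R, s \in `[0, 1] -> `|s - t| < d -> `|phi s - phi t| <= e) ->
  (forall t : R, t \in `[0, 1] -> `|phi t| <= K) ->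
  exists g : R -> R, [/\ measurable_fun setT g, forall t, 0 <= g t <= M,
    forall t, t \notin `[0, 1] -> g t = 0 &
    {ae mu, forall t : R, t \in `[0, 1] -> g t = F t (phi t)}].
Proof.
move=> M0 phi_cont phiK.
pose v n k := phi (k%:R / n.+1%:R).
pose p n (s : R) : R := (Num.trunc (s * n.+1%:R))%:R / n.+1%:R.
have nR n : 0 < n.+1%:R :> R by [].
have node01 n k : (k <= n.+1)%N -> k%:R / n.+1%:R \in `[0 : R, 1].
  by move=> kn; rewrite in_itv/= divr_ge0//= ler_pdivrMr// mul1r ler_nat.
have trunc_le n (s : R) : s \in `[0, 1] -> (Num.trunc (s * n.+1%:R) <= n.+1)%N.
  rewrite in_itv/= => /andP[s0 s1].
  have /andP[H _] := @truncn_itv _ (s * n.+1%:R) (mulr_ge0 s0 (ltW (nR n))).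
  by rewrite -(ler_nat R); apply: le_trans H _; rewrite ler_piMl.
have p01 n (s : R) : s \in `[0, 1] -> p n s \in `[0 : R, 1].
  by move=> s01; apply/node01/trunc_le.
have ps n (s : R) : s \in `[0, 1] -> `|p n s - s| <= n.+1%:R^-1.
  rewrite in_itv/= => /andP[s0 s1].
  have /andP[] := @truncn_itv _ (s * n.+1%:R) (mulr_ge0 s0 (ltW (nR n))).
  rewrite -ler_pdivrMr// -ltr_pdivlMr// -/(p n s) -natr1 mulrDl mul1r -/(p n s).
  by move=> H1 H2; rewrite ler_norml; apply/andP; split; move: H1 H2; move: (p n s) (_^-1) => a b; lra.
(* The bound is asked only for [k <= n.+1], as later nodes leave [[0, 1]], where [phi] is not
   controlled. The node [n.+1] does occur, since [p n 1 = 1]. *)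
have /choice[Z ZP] : forall nk : nat * nat, exists Z : set R, [/\ measurable Z,
    mu Z = 0%E, measurable_fun (`[0, 1] `\` Z) (F ^~ (v nk.1 nk.2)) &
    (nk.2 <= nk.1.+1)%N -> forall t, t \in `[0, 1] -> ~ Z t -> F t (v nk.1 nk.2) <= M].
  move=> [n k] /=.
  have [Z1 [mZ1 Z10 mF]] := lebesgue_measurable_fun_borel (measurable_itv `[0, 1])
    (F_measurable (v n k)).
  have [kn|kn] := leqP k n.+1; last by exists Z1; split.
  have [Z2 [mZ2 Z20 FM]] := F_le (phiK _ (node01 _ _ kn)).
  exists (Z1 `|` Z2); split.
  - exact: measurableU.
  - by rewrite measureU0.
  - apply: measurable_funS mF; first exact: measurableD.
    by move=> t [t01 nt]; split=> // Zt; apply: nt; left.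
  - move=> _ t t01 nt; apply: contrapT => nF; apply: nt; right.
    by apply: FM => /= H; apply: nF; exact: H.
have [A [mA A0 contA]] := F_continuous.
pose N := A `|` \bigcup_n \bigcup_k Z (n, k).
have mN : measurable N.
  apply: measurableU => //; apply: bigcupT_measurable => n.
  by apply: bigcupT_measurable => k; have [] := ZP (n, k).
have N0 : mu N = 0%E.
  rewrite measureU0//.
    apply: bigcupT_measurable => n.
    by apply: bigcupT_measurable => k; have [] := ZP (n, k).
  apply: bigcup_null => n.
    by apply: bigcupT_measurable => k; have [] := ZP (n, k).
  by apply: bigcup_null => k; have [] := ZP (n, k).
pose E := `[0, 1] `\` N.
have mE : measurable E by apply: measurableD.
have E01 t : E t -> t \in `[0, 1] by case.
have EP t : E t -> continuous (F t) /\
    forall n k, (k <= n.+1)%N -> F t (v n k) <= M.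
  move=> [t01 Nt]; split=> [|n k kn].
    apply: contrapT => nF; apply: Nt; left; apply: contA => /= H.
    by apply: nF; exact: H.
  have [_ _ _] := ZP (n, k); apply=> // Zt; apply: Nt; right.
  by exists n => //; exists k.
have hE n (s : R) : s \in `[0, 1] -> F s (phi (p n s)) = F s (v n (Num.trunc (s * n.+1%:R))).
  by [].
have mh n : measurable_fun E (fun s => F s (phi (p n s))).
  pose I k : set R := [set` `[k%:R / n.+1%:R, k.+1%:R / n.+1%:R[].
  have -> : E = \bigcup_k (E `&` I k).
    rewrite -setI_bigcupr; apply/seteqP; split=> [t Et|t []//]; split=> //.
    have := E01 _ Et; rewrite in_itv/= => /andP[t0 t1].
    have /andP[H1 H2] := @truncn_itv _ (t * n.+1%:R) (mulr_ge0 t0 (ltW (nR n))).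
    exists (Num.trunc (t * n.+1%:R)) => //; rewrite /I /= in_itv/=.
    by rewrite ler_pdivrMr// H1 ltr_pdivlMr.
  apply/measurable_fun_bigcup => [k|k]; first by apply: measurableI => //; exact: measurable_itv.
  apply: (@eq_measurable_fun _ _ _ _ _ (fun s => F s (v n k))).
    move=> s; rewrite inE => -[Es Is]; congr (F s (phi (_ / _))); congr (_%:R).
    move: Is; rewrite /I /= in_itv/= ler_pdivrMr// ltr_pdivlMr// => Hk.
    by apply/esym/truncn_def.
  have [_ _ + _] := ZP (n, k); apply: measurable_funS.
    by apply: measurableD => //; have [] := ZP (n, k).
  move=> s [[s01 Ns] _]; split=> // Zs; apply: Ns; right.
  by exists n => //; exists k.
have cvh s : E s -> F s (phi (p n s)) @[n --> \oo] --> F s (phi s).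
  move=> Es; have s01 := E01 _ Es; have [Fs _] := EP _ Es.
  apply: (@cvg_comp _ _ _ (fun n => phi (p n s)) (F s) _ (nbhs (phi s))); last exact: Fs.
  apply/cvgrPdist_le => e e0; have [d d0 H] := phi_cont _ s01 _ e0.
  near=> n; rewrite distrC; apply: H; first exact: p01.
  apply: le_lt_trans (ps _ _ s01) _; near: n.
  exact: near_infty_natSinv_lt (PosNum d0).
(* The value 0 off [E] makes measurability and the bounds hold on the whole line, not just almost
   everywhere. *)
exists ((fun s => F s (phi s)) \_ E); split.
- apply/(measurable_restrictT _ mE); exact: (measurable_fun_cvg mh cvh).
- move=> t; rewrite patchE; case: ifPn; rewrite ?lexx ?M0// inE => Et.
  rewrite F_ge0 ?E01//=.
  apply: (ler_cvg_to (cvh _ Et) (cvg_cst M)); near=> n.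
  by rewrite hE ?E01//; apply: (EP _ Et).2; apply/trunc_le/E01.
- move=> t t01; rewrite patchE memNset// => /E01; exact/negP.
- exists N; split=> // t /= nt; apply: contrapT => Nt; apply: nt => t01.
  by rewrite patchE mem_set.
Unshelve. all: by end_near. Qed.

End superposition.

(** * One-sided derivatives and repeated primitives *)

Section one_sided_derivatives.
Context {R : realType}.
Implicit Types (a b t s l k : R) (f g h : R -> R).

Lemma has_deriv_itvD a b f g t l k : has_deriv_itv a b f t l ->
  has_deriv_itv a b g t k -> has_deriv_itv a b (f \+ g) t (l + k).
Proof.
move=> Hf Hg e e0; have e2 : 0 < e / 2 by rewrite divr_gt0.
have [d d0 {}Hf] := Hf _ e2; have [d' d'0 {}Hg] := Hg _ e2.
exists (Num.min d d'); first by rewrite lt_min d0.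
move=> s sab; rewrite lt_min => /andP[sd sd'] /=.
have -> : f s + g s - (f t + g t) - (l + k) * (s - t) =
  (f s - f t - l * (s - t)) + (g s - g t - k * (s - t)) by ring.
apply: le_trans (ler_normD _ _) _.
by have := Hf _ sab sd; have := Hg _ sab sd'; lra.
Qed.

Lemma has_deriv_itvZ a b c f t l : has_deriv_itv a b f t l ->
  has_deriv_itv a b (fun s => c * f s) t (c * l).
Proof.
move=> Hf e e0; have c0 : 0 < `|c| + 1 by rewrite ltr_wpDl.
have [d d0 {}Hf] := Hf (e / (`|c| + 1)) (divr_gt0 e0 c0).
exists d => // s sab /(Hf _ sab) H.
have -> : c * f s - c * f t - c * l * (s - t) = c * (f s - f t - l * (s - t)) by ring.
rewrite normrM; apply: le_trans (ler_wpM2l (normr_ge0 c) H) _.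
rewrite mulrA ler_wpM2r// mulrCA ler_piMr//; first exact: ltW.
by rewrite ler_pdivrMr// mul1r lerDl.
Qed.

Lemma is_derive_has_deriv_itv a b f t l : is_derive t 1 f l -> has_deriv_itv a b f t l.
Proof.
move=> [df <-] e e0.
have /cvgrPdist_le/(_ _ e0)[d /= d0 H] :
  h^-1 *: (f (h *: 1 + t) - f t) @[h --> 0^'] --> 'D_1 f t := df.
exists d => // s _ st.
have [->|neq] := eqVneq s t; first by rewrite !subrr mulr0 subr0 normr0 mulr0.
have st0 : s - t != 0 by rewrite subr_eq0.
have /= := H (s - t); rewrite sub0r normrN => /(_ st st0).
rewrite distrC -(ler_pM2r (_ : 0 < `|s - t|)) ?normr_gt0// -normrM.
rewrite -[_%:A]/((s - t) * 1) mulr1 subrK.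
by rewrite mulrBl -[_ *: _]/((s - t)^-1 * (f s - f t)) mulrAC mulVf// mul1r.
Qed.

Lemma derivn_itv_chain a b (f : nat -> R -> R) n : a < b ->
  (forall i, (i < n)%N -> forall t, t \in `[a, b] -> has_deriv_itv a b (f i) t (f i.+1 t)) ->
  (forall i, (i <= n)%N -> {in `[a, b], derivn_itv a b i (f 0%N) =1 f i}) /\
  (forall i, (i < n)%N -> forall t, t \in `[a, b] ->
     derivable_itv a b (derivn_itv a b i (f 0%N)) t).
Proof.
move=> ab H.
have E i : (i <= n)%N -> {in `[a, b], derivn_itv a b i (f 0%N) =1 f i}.
  elim: i => [//|i IH] ni t tab; rewrite /derivn_itv iterS -/(derivn_itv a b i _).
  apply: has_deriv_itvE => //; apply: has_deriv_itv_eq (H _ ni _ tab) => //.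
  by move=> s sab; rewrite IH// ltnW.
split=> // i ni t tab; apply/derivable_itvP => //.
have hd : has_deriv_itv a b (derivn_itv a b i (f 0%N)) t (f i.+1 t).
  by apply: has_deriv_itv_eq (H _ ni _ tab) => // s sab; rewrite E// ltnW.
by rewrite (has_deriv_itvE ab tab hd).
Qed.

(** Heine's theorem by contradiction. With index type [unit], [pointwise_cluster] acts as
    Bolzano-Weierstrass on the first components of the bad pairs; the second components follow. *)
Lemma itv_uniform_continuous a b f : {within `[a, b], continuous f} ->
  forall e : R, 0 < e -> exists2 d : R, 0 < d & forall s t, s \in `[a, b] -> t \in `[a, b] ->
    `|s - t| < d -> `|f s - f t| <= e.
Proof.
move=> /within_itv_continuousP cf e e0; apply: contrapT => nH.
have /choice[x xP] : forall k : nat, exists x : R * R, [/\ x.1 \in `[a, b], x.2 \in `[a, b],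
    `|x.1 - x.2| < k.+1%:R^-1 & e < `|f x.1 - f x.2|].
  move=> k; apply: contrapT => nx; apply: nH; exists k.+1%:R^-1; first by rewrite invr_gt0.
  move=> s t sab tab st; rewrite leNgt; apply/negP => fst.
  by apply: nx; exists (s, t).
have [|y cly] := @pointwise_cluster _ unit (`|a| + `|b|) (fun (k : nat) _ => (x k).1).
  move=> k _; have [+ _ _ _] := xP k; rewrite in_itv/= => /andP[ax xb].
  have := ler_norm b; have := ler_norm (- a); rewrite normrN ler_norml => *.
  have := normr_ge0 a; have := normr_ge0 b => *.
  by apply/andP; split; lra.
have yab : y tt \in `[a, b].
  rewrite in_itv/=; apply/andP; split; apply/ler_addgt0Pr => z z0.
    have [k _ H] := cly [:: tt] z 0%N z0; have := H tt; rewrite inE => /(_ isT).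
    have [+ _ _ _] := xP k; rewrite in_itv/= => /andP[ax xb].
    by rewrite ltr_norml => /andP[? ?]; lra.
  have [k _ H] := cly [:: tt] z 0%N z0; have := H tt; rewrite inE => /(_ isT).
  have [+ _ _ _] := xP k; rewrite in_itv/= => /andP[ax xb].
  by rewrite ltr_norml => /andP[? ?]; lra.
have [d d0 Hd] := cf _ yab (e / 2) (divr_gt0 e0 (ltr0Sn _ _)).
have d2 : 0 < d / 2 by rewrite divr_gt0.
have [m Hm] : exists m, m.+1%:R^-1 < d / 2.
  have [m _ Hm] := @near_infty_natSinv_lt R (PosNum d2).
  by exists m; exact: (Hm m (leqnn m)).
have [k mk H] := cly [:: tt] _ m d2; have := H tt; rewrite inE => /(_ isT) ky.
have [x1 x2 x12 fx] := xP k.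
have km : k.+1%:R^-1 <= m.+1%:R^-1 :> R by rewrite lef_pV2 ?posrE// ler_nat ltnS.
have h1 : `|(x k).1 - y tt| < d by apply: lt_trans ky _; lra.
have h2 : `|(x k).2 - y tt| < d.
  apply: le_lt_trans (ler_distD (x k).1 _ _) _; rewrite distrC.
  by move: ky x12 km Hm; move: (k.+1%:R^-1) (m.+1%:R^-1) => p q; lra.
have := ler_distD (f (y tt)) (f (x k).1) (f (x k).2).
have := Hd _ x1 h1; have := Hd _ x2 h2; rewrite [`|f (y tt) - _|]distrC.
by move: fx; lra.
Qed.

End one_sided_derivatives.

Section primitive.
Context {R : realType}.
Local Notation mu := (@lebesgue_measure R).
Implicit Types (h : R -> R) (s t c : R).

(* The lower bound is any negative number: it only has to make 0 an interior
   point of the domain of integration of functions vanishing for [t <= 0]. *)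
Definition prim h t : R := \int[mu]_(s in `[-1, t]) h s.

Definition bounded_measurable (h : R -> R) :=
  measurable_fun setT h /\ exists c, forall t, `|h t| <= c.

Lemma bounded_measurable_integrable h (a b : R) : bounded_measurable h ->
  mu.-integrable `[a, b] (EFin \o h).
Proof.
move=> [mh [c hc]]; apply: measurable_bounded_integrable => //.
- by rewrite [X in (X < _)%E](lebesgue_measure_itv `[a, b])/=; case: ifP; rewrite ?ltry.
- exact: measurable_funS mh.
- exists c; split; first exact: num_real.
  by move=> x cx t _ /=; apply: le_trans (hc t) (ltW cx).
Qed.

Lemma Rintegral_itv_cst (a b c : R) : a <= b ->
  \int[mu]_(s in `[a, b]) cst c s = c * (b - a).
Proof.
move=> ab; rewrite Rintegral_cst//= [X in fine X](lebesgue_measure_itv `[a, b])/= lte_fin.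
by case: ltgtP ab => // -> _; rewrite subrr.
Qed.

Lemma Rintegral_itv_le h (a b c : R) : a <= b ->
  mu.-integrable `[a, b] (EFin \o h) ->
  (forall t, t \in `[a, b] -> `|h t| <= c) ->
  `|\int[mu]_(s in `[a, b]) h s| <= c * (b - a).
Proof.
move=> ab ih hc; apply: le_trans (le_normr_Rintegral _ ih) _ => //.
rewrite -(Rintegral_itv_cst c ab); apply: le_Rintegral => //.
- exact: integrable_norm ih.
- by apply: bounded_measurable_integrable; split=> //; exists `|c|.
Qed.

Lemma prim_increment h a b : -1 <= a -> a <= b ->
  mu.-integrable `[-1, b] (EFin \o h) ->
  prim h b - prim h a = \int[mu]_(s in `[a, b]) h s.
Proof.
move=> a1 ab ih; rewrite /prim Rintegral_itvB ?bnd_simp//.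
rewrite Rintegral_itv_obnd_cbnd//.
apply: integrableS ih => //.
by move=> s /=; rewrite !in_itv/= => /andP[/ltW as_ ->]; rewrite (le_trans a1).
Qed.

Lemma prim_le0 h t : (forall s, s <= 0 -> h s = 0) -> t <= 0 -> prim h t = 0.
Proof.
move=> h0 t0; rewrite /prim (@eq_Rintegral _ _ _ _ _ (cst 0)).
  by rewrite Rintegral_cst//= mul0r.
by move=> s; rewrite inE/= in_itv/= => /andP[_ st]; rewrite h0// (le_trans st).
Qed.

Lemma continuous_integrable h (a b : R) : continuous h ->
  mu.-integrable `[a, b] (EFin \o h).
Proof.
move=> ch; apply: continuous_compact_integrable; first exact: segment_compact.
exact: continuous_subspaceT.
Qed.

(** The integrands vanish up to 0, so for [t <= 1] the effective domain has length at most 1 and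
    integration does not enlarge a uniform distance. *)
Lemma prim_dist h h' t c : continuous h -> continuous h' ->
  (forall s, s <= 0 -> h s = 0) -> (forall s, s <= 0 -> h' s = 0) ->
  (forall s, s <= 1 -> `|h s - h' s| <= c) -> t <= 1 ->
  `|prim h t - prim h' t| <= c.
Proof.
move=> ch ch' h0 h'0 hc t1.
have c0 : 0 <= c by apply: le_trans (hc 0 ler01).
have [t0|/ltW t0] := leP t 0; first by rewrite !prim_le0// subrr normr0.
have m1 : -1 <= 0 :> R by rewrite lerN10.
have primE (k : R -> R) : continuous k -> (forall s, s <= 0 -> k s = 0) ->
    prim k t = \int[mu]_(s in `[0, t]) k s.
  move=> ck k0; rewrite -prim_increment//; last exact: continuous_integrable.
  by rewrite (prim_le0 k0 (lexx 0)) subr0.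
rewrite !primE//.
rewrite -RintegralB//; try exact: continuous_integrable.
apply: (@le_trans _ _ (c * (t - 0))); last by rewrite subr0 ler_piMr.
apply: Rintegral_itv_le => //.
  apply: continuous_integrable => s; apply: cvgB; [exact: ch|exact: ch'].
by move=> s; rewrite in_itv/= => /andP[_ st]; apply: hc; exact: le_trans t1.
Qed.

Lemma prim_ge0 h t : (forall s, 0 <= h s) -> 0 <= prim h t.
Proof. by move=> h0; apply: Rintegral_ge0 => s _. Qed.

Lemma prim_is_derive h t : continuous h -> (forall s, s <= 0 -> h s = 0) ->
  is_derive t (1 : R) (prim h) (h t).
Proof.
(* The fundamental theorem requires [t] to lie beyond the lower bound of integration; for [t <= -1]
   the primitive is 0 near [t]. *)
move=> ch h0; have [t1|t1] := ltP (-1) t.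
  have tt1 : t < t + 1 by rewrite ltrDl.
  have [//||d1 d2] := @continuous_FTC1 R h (BLeft (-1)) t (t + 1) tt1
      (continuous_integrable _ _ ch).
    exact: ch.
  by split; [exact: d1|rewrite -derive1E d2].
rewrite h0; last by apply: le_trans t1 _; rewrite lerN10.
apply: (@near_eq_is_derive _ _ _ (cst 0)) => //.
near=> s; rewrite prim_le0//.
apply: ltW; near: s; apply: (cvgr_lt t); first exact: cvg_id.
by apply: le_lt_trans t1 _; rewrite ltrN10.
Unshelve. all: by end_near. Qed.

Lemma prim_continuous h : continuous h -> (forall s, s <= 0 -> h s = 0) ->
  continuous (prim h).
Proof.
move=> ch h0 t; apply: differentiable_continuous; apply/derivable1_diffP.
by have [] := prim_is_derive t ch h0.
Qed.

End primitive.

(** * Cone elements built from profiles, and their segments *)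

Section double_primitives.
Context {R : realType} (r rho : R) (r_gt0 : 0 < r) (rho_gt0 : 0 < rho).
Implicit Types (w : R -> R) (s t c : R).

Lemma C2_derivnB (a b : R) (f g : C2 a b) i t : (i <= 2)%N ->
  derivn_itv a b i (f - g) t = derivn_itv a b i f t - derivn_itv a b i g t.
Proof. by move=> i2; rewrite C2_derivnD// -(scaleN1r g) C2_derivnZ// mulN1r. Qed.

Lemma derivn_toC2 (a b : R) (f : R -> R) i t : a < b -> is_Cn 2 a b f -> (i <= 2)%N ->
  t \in `[a, b] -> derivn_itv a b i (toC2 a b f) t = derivn_itv a b i f t.
Proof.
move=> ab cf i2 tab; have [g [h [fg gh ch]]] := iffLR (is_C2P f ab) cf.
have fg' s : s \in `[a, b] -> has_deriv_itv a b (toC2 a b f) s (g s).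
  move=> sab; apply: has_deriv_itv_eq (fg _ sab) => // x xab.
  by rewrite toC2E.
have [E1 E2] := is_C2_derivE ab fg gh tab.
have [E1' E2'] := is_C2_derivE ab fg' gh tab.
case: i i2 => [|[|[|//]]] _; first by rewrite /= toC2E.
  by rewrite E1 E1'.
by rewrite E2 E2'.
Qed.

Definition double_prim w : C2 (- r) 1 := toC2 (- r) 1 (prim (prim w)).

Section double_prim_of_profile.
Variable w : R -> R.
Hypothesis pw : profile rho w.

Let w0 s : s <= 0 -> w s = 0. Proof. by move=> s0; have [+ _ _ _] := pw; apply. Qed.
Let wc : continuous w. Proof. by have [] := pw. Qed.
Let W0 s : s <= 0 -> prim w s = 0. Proof. exact: prim_le0. Qed.
Let Wc : continuous (prim w). Proof. exact: prim_continuous. Qed.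

Lemma has_deriv_itv_prim2 (a b t : R) :
  has_deriv_itv a b (prim (prim w)) t (prim w t) /\ has_deriv_itv a b (prim w) t (w t).
Proof. by split; apply: is_derive_has_deriv_itv; exact: prim_is_derive. Qed.

Let r1 : - r < 1. Proof. by move: r_gt0; lra. Qed.

Lemma prim2_C2 : is_Cn 2 (- r) 1 (prim (prim w)).
Proof.
apply/is_C2P => //; exists (prim w), w; split=> [t _|t _|].
- exact: (has_deriv_itv_prim2 _ _ _).1.
- exact: (has_deriv_itv_prim2 _ _ _).2.
- exact: continuous_subspaceT.
Qed.

Lemma double_prim_derivn i t : (i <= 2)%N -> t \in `[- r, 1] ->
  derivn_itv (- r) 1 i (double_prim w) t = iter (2 - i) prim w t.
Proof.
move=> i2 tr; rewrite (derivn_toC2 r1 prim2_C2 i2 tr).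
have [E1 E2] := is_C2_derivE r1 (fun s _ => (has_deriv_itv_prim2 (- r) 1 s).1)
  (fun s _ => (has_deriv_itv_prim2 (- r) 1 s).2) tr.
by case: i i2 => [|[|[|//]]].
Qed.

Lemma iter_prim_regular k : continuous (iter k prim w) /\
  forall s, s <= 0 -> iter k prim w s = 0.
Proof.
elim: k => [//|k [ck k0]]; split; first exact: prim_continuous.
by move=> s s0; exact: prim_le0.
Qed.

Lemma K0_double_prim : K0 (double_prim w).
Proof.
split=> [t tr|t].
  have := double_prim_derivn (i := 0) isT tr; rewrite [LHS]/= => ->.
  by apply: prim_ge0 => s; apply: prim_ge0 => s'; have /andP[] := profile_itv s' pw.
rewrite in_itv/= => /andP[rt t0].
have tr : t \in `[- r, 1] by rewrite in_itv/= rt (le_trans t0).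
have E i (i2 : (i <= 2)%N) := etrans (double_prim_derivn i2 tr) ((iter_prim_regular _).2 _ t0).
by split; [exact: (E 0%N)|exact: (E 1%N)|exact: (E 2%N)].
Qed.

End double_prim_of_profile.

Lemma iter_prim_dist w w' c k t : profile rho w -> profile rho w' ->
  (forall s, `|w s - w' s| <= c) -> t <= 1 ->
  `|iter k prim w t - iter k prim w' t| <= c.
Proof.
move=> pw pw' wc; elim: k t => [|k IH] t t1; first exact: wc.
have [ck k0] := iter_prim_regular pw k; have [ck' k0'] := iter_prim_regular pw' k.
exact: prim_dist.
Qed.

Lemma double_prim_dist w w' c : profile rho w -> profile rho w' ->
  (forall t, `|w t - w' t| <= c) -> `|double_prim w - double_prim w'| <= c.
Proof.
move=> pw pw' wc; have c0 : 0 <= c by apply: le_trans (wc 0).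
rewrite C2_normE; apply/(normC2_leP (C2_is_Cn _) c0) => i i2 t tr.
rewrite (C2_derivnB _ _ _ i2).
rewrite [X in X - _](double_prim_derivn pw i2 tr) [X in _ - X](double_prim_derivn pw' i2 tr).
by apply: iter_prim_dist => //; move: tr; rewrite in_itv/= => /andP[].
Qed.

(** The bound [rho] on [w] passes to both primitives by comparison with the zero function, and the
    second derivative attains [rho] at 1. *)
Lemma double_prim_norm w : profile rho w -> `|double_prim w| = rho.
Proof.
move=> pw; have [w0 w1 _ cw] := pw; apply/eqP; rewrite eq_le; apply/andP; split.
  rewrite C2_normE; apply/(normC2_leP (C2_is_Cn _)) => [|i i2 t tr]; first exact: ltW.
  rewrite (double_prim_derivn pw i2 tr).
  have t1 : t <= 1 by move: tr; rewrite in_itv/= => /andP[].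
  elim: (2 - i)%N t t1 {tr} => [|k IH] t t1.
    by have /andP[? ?] := profile_itv t pw; rewrite /= ger0_norm.
  have [ck k0] := iter_prim_regular pw k.
  rewrite iterS -[prim _ t]subr0 -[X in _ - X](_ : prim (cst 0) t = 0); last first.
    by rewrite /prim Rintegral_cst//= mul0r.
  apply: prim_dist => //; first by move=> s; exact: cvg_cst.
  by move=> s s1; rewrite subr0; exact: IH.
have r11 : 1 \in `[- r, 1] by rewrite in_itv/= lexx andbT; move: r_gt0; lra.
have := normC2_ub (C2_is_Cn (double_prim w)) (isT : (2 <= 2)%N) r11.
by rewrite (double_prim_derivn pw (isT : (2 <= 2)%N) r11) /= w1// ger0_norm// ltW.
Qed.

Lemma segment_C2 (u : C2 (- r) 1) t : t \in `[0, 1] ->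
  is_Cn 2 (- r) 0 (fun theta => u (t + theta)) /\
  forall theta, theta \in `[- r, 0] -> t + theta \in `[- r, 1] /\ forall i, (i <= 2)%N ->
    derivn_itv (- r) 0 i (segment u t) theta = derivn_itv (- r) 1 i u (t + theta).
Proof.
rewrite in_itv/= => /andP[t0 t1].
have r1 : - r < 1 by move: r_gt0; lra.
have r0 : - r < 0 by rewrite oppr_lt0.
have sub theta : theta \in `[- r, 0] -> t + theta \in `[- r, 1].
  by rewrite !in_itv/= => /andP[? ?]; apply/andP; split; lra.
have [c2 E] := is_C2_shift r1 r0 sub (C2_is_Cn u).
split=> // theta thr; split; first exact: sub.
by move=> i i2; rewrite derivn_toC2// E.
Qed.

Lemma segment_norm (u : C2 (- r) 1) t : t \in `[0, 1] -> `|segment u t| <= `|u|.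
Proof.
move=> t01; rewrite C2_normE; apply/(normC2_leP (C2_is_Cn _)) => // i i2 th thr.
have [_ /(_ _ thr)[tr ->//]] := segment_C2 u t01.
by apply: normC2_ub => //; exact: C2_is_Cn.
Qed.

Lemma segment_dist (u v : C2 (- r) 1) t : t \in `[0, 1] ->
  `|segment u t - segment v t| <= `|u - v|.
Proof.
move=> t01; rewrite [X in X <= _]C2_normE; apply/(normC2_leP (C2_is_Cn _)) => // i i2 th thr.
have [_ /(_ _ thr)[tr Eu]] := segment_C2 u t01.
have [_ /(_ _ thr)[_ Ev]] := segment_C2 v t01.
rewrite C2_derivnB// Eu// Ev// -C2_derivnB//.
by apply: normC2_ub => //; exact: C2_is_Cn.
Qed.

(** Uniform continuity of [u] and its two derivatives on all of [[- r, 1]] controls every shift at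
    once. This makes [t |-> u_t] an admissible [phi] for [caratheodory_superposition]. *)
Lemma segment_continuous (u : C2 (- r) 1) (e : R) : 0 < e -> exists2 d : R, 0 < d &
  forall s t, s \in `[0, 1] -> t \in `[0, 1] -> `|s - t| < d ->
    `|segment u s - segment u t| <= e.
Proof.
move=> e0.
have uc i : (i <= 2)%N -> exists2 d : R, 0 < d &
    forall s t, s \in `[- r, 1] -> t \in `[- r, 1] -> `|s - t| < d ->
    `|derivn_itv (- r) 1 i u s - derivn_itv (- r) 1 i u t| <= e.
  by move=> i2; apply: itv_uniform_continuous => //; exact: is_C2_continuous (C2_is_Cn u) _ i2.
have [d0 d00 H0] := uc 0%N isT; have [d1 d10 H1] := uc 1%N isT.
have [d2 d20 H2] := uc 2%N isT.
exists (Num.min d0 (Num.min d1 d2)); first by rewrite !lt_min d00 d10.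
move=> s t s01 t01; rewrite !lt_min => /and3P[st0 st1 st2].
rewrite C2_normE; apply/(normC2_leP (C2_is_Cn _)) => [|i i2 th thr]; first exact: ltW.
have [_ /(_ _ thr)[sr Es]] := segment_C2 u s01.
have [_ /(_ _ thr)[tr Et]] := segment_C2 u t01.
rewrite C2_derivnB// Es// Et//.
have eqd : s + th - (t + th) = s - t by ring.
by case: i i2 Es Et => [|[|[|//]]] _ _ _; [apply: H0|apply: H1|apply: H2]; rewrite ?eqd.
Qed.

End double_primitives.

(** * The linear boundary value problem *)

Section response.
Context {R : realType}.
Local Notation mu := (@lebesgue_measure R).
Implicit Types (s t tau c : R).

(* [response b g] is the second derivative of the solution of [v'''' = - g],
   [v 0 = v' 0 = v'' 0 = 0], [v''' 1 = b], and [slope b g] is its third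
   derivative: [min (t, s)] is the Green function of [w'' = - g], [w 0 = 0],
   [w' 1 = 0]. *)
Definition response (b : R) (g : R -> R) t : R := b * clamp01 t +
  \int[mu]_(s in `[0, 1]) (Num.min (clamp01 t) s * g s).

Definition slope (b : R) (g : R -> R) t : R := b + (prim g 1 - prim g t).

Section density.
Variables (M b : R) (g : R -> R).
Hypotheses (b_ge0 : 0 <= b) (g_measurable : measurable_fun setT g)
  (g_itv : forall t, 0 <= g t <= M) (g_out : forall t, t \notin `[0, 1] -> g t = 0).

Let M0 : 0 <= M. Proof. by have /andP[? ?] := g_itv 0; exact: (@le_trans _ _ (g 0)). Qed.

Lemma bounded_measurable_density : bounded_measurable g.
Proof.
by split=> //; exists M => t; have /andP[? ?] := g_itv t; rewrite ger0_norm.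
Qed.

Let bg := bounded_measurable_density.

Lemma bounded_measurable_mul (f : R -> R) : measurable_fun setT f ->
  (forall t, t \in `[0, 1] -> `|f t| <= 1) -> bounded_measurable (fun t => f t * g t).
Proof.
move=> mf f1; split; first exact: measurable_funM.
exists M => t; have [t01|t01] := boolP (t \in `[0, 1]); last first.
  by rewrite g_out// mulr0 normr0.
have /andP[g0 gM] := g_itv t; rewrite normrM (ger0_norm g0) -[leRHS]mul1r.
by apply: ler_pM => //; exact: f1.
Qed.

Lemma bounded_measurable_min c : 0 <= c <= 1 ->
  bounded_measurable (fun t => Num.min c t * g t).
Proof.
move=> /andP[c0 c1]; apply: bounded_measurable_mul.
  by apply: measurable_minr => //; exact: measurable_cst.
move=> t; rewrite in_itv/= => /andP[t0 t1]; rewrite ger0_norm ?le_min ?c0//.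
by rewrite ge_min c1.
Qed.

Let Rintegral_split (h : R -> R) (c d e : R) : bounded_measurable h ->
  -1 <= c -> c <= d -> d <= e ->
  \int[mu]_(s in `[c, e]) h s = \int[mu]_(s in `[c, d]) h s + \int[mu]_(s in `[d, e]) h s.
Proof.
move=> bh c1 cd de; have c1d := le_trans c1 cd; have ce := le_trans cd de.
have ih x := bounded_measurable_integrable (-1) x bh.
by rewrite -!prim_increment//; ring.
Qed.

Lemma prim_density_increment s t : 0 <= s -> s <= t ->
  0 <= prim g t - prim g s <= M * (t - s).
Proof.
move=> s0 st; have m1 : -1 <= s by apply: le_trans s0; rewrite lerN10.
rewrite prim_increment//; last exact: bounded_measurable_integrable.
apply/andP; split; first by apply: Rintegral_ge0 => x _; have /andP[] := g_itv x.
apply: le_trans (ler_norm _) _; apply: Rintegral_itv_le => //.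
  exact: bounded_measurable_integrable.
by move=> x _; have /andP[? ?] := g_itv x; rewrite ger0_norm.
Qed.

Lemma slope_itv t : t \in `[0, 1] -> 0 <= slope b g t <= b + M.
Proof.
rewrite in_itv/= => /andP[t0 t1]; have /andP[H1 H2] := prim_density_increment t0 t1.
rewrite /slope; apply/andP; split; first by rewrite addr_ge0.
by rewrite lerD2l; apply: le_trans H2 _; rewrite ler_piMr// gerBl.
Qed.

Lemma slope_lipschitz s t : s \in `[0, 1] -> t \in `[0, 1] ->
  `|slope b g t - slope b g s| <= M * `|t - s|.
Proof.
wlog st : s t / s <= t.
  move=> H s01 t01; have [st|/ltW ts] := leP s t; first exact: H.
  by rewrite distrC [`|t - s|]distrC; exact: H.
rewrite !in_itv/= => /andP[s0 _] _.
have /andP[H1 H2] := prim_density_increment s0 st.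
rewrite /slope (_ : _ - _ = - (prim g t - prim g s)); last by ring.
by rewrite normrN (ger0_norm H1) ger0_norm// subr_ge0.
Qed.

(** As a function of [tau], [min t tau - min s tau] is 0 up to [s], equals [t - s] from [t] on, and
    lies between these values otherwise; comparison with the tails of [g] gives both bounds. This
    concavity estimate yields the monotonicity, the Lipschitz bound and the derivative of
    [response]. *)
Lemma response_increment s t : 0 <= s -> s <= t -> t <= 1 ->
  (t - s) * slope b g t <= response b g t - response b g s <= (t - s) * slope b g s.
Proof.
move=> s0 st t1; have t0 := le_trans s0 st; have s1 := le_trans st t1.
have m0 : -1 <= 0 :> R by rewrite lerN10.
have ms : -1 <= s by apply: le_trans s0.
have mt : -1 <= t by apply: le_trans t0.
have g0 tau : 0 <= g tau by have /andP[] := g_itv tau.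
pose q tau := (Num.min t tau - Num.min s tau) * g tau.
have mq : measurable_fun setT (fun tau => Num.min t tau - Num.min s tau).
  by apply: measurable_funB; apply: measurable_minr => //; exact: measurable_cst.
have bq : bounded_measurable q.
  apply: bounded_measurable_mul => // tau; rewrite in_itv/= => /andP[tau0 tau1].
  by rewrite ler_norml /Order.min; do 2 case: ltP => ?; apply/andP; split; lra.
have bz (z : R) : bounded_measurable (fun tau => z * g tau).
  have [mg [c gc]] := bg; split.
    by apply: measurable_funM => //; exact: measurable_cst.
  by exists (`|z| * c) => tau; rewrite normrM ler_wpM2l.
have qE : response b g t - response b g s = b * (t - s) + \int[mu]_(tau in `[0, 1]) q tau.
  rewrite /response !clamp01_id//.
  rewrite (_ : \int[mu]_(tau in `[0, 1]) q tau =
    \int[mu]_(tau in `[0, 1]) (Num.min t tau * g tau) -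
    \int[mu]_(tau in `[0, 1]) (Num.min s tau * g tau)); first by ring.
  rewrite -RintegralB//; try by apply: bounded_measurable_integrable;
    apply: bounded_measurable_min; apply/andP.
  by apply: eq_Rintegral => tau _; rewrite /q /= mulrBl.
have slopeE z : 0 <= z -> z <= 1 -> (t - s) * slope b g z =
    b * (t - s) + \int[mu]_(tau in `[z, 1]) ((t - s) * g tau).
  move=> z0 z1; have mz : -1 <= z by apply: le_trans z0.
  rewrite RintegralZl//; last exact: bounded_measurable_integrable.
  rewrite /slope prim_increment//; first by ring.
  exact: bounded_measurable_integrable.
rewrite qE !slopeE// !lerD2l; apply/andP; split.
  rewrite (Rintegral_split (d := t) bq)// -[leLHS]add0r; apply: lerD.
    apply: Rintegral_ge0 => tau; rewrite /= in_itv/= => /andP[tau0 taut].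
    by rewrite /q mulr_ge0// /Order.min; do 2 case: ltP => ?; lra.
  apply: le_Rintegral => //; try exact: bounded_measurable_integrable.
  move=> tau; rewrite /= in_itv/= => /andP[ttau tau1]; rewrite /q ler_wpM2r//.
  by rewrite !min_l// (le_trans st).
rewrite (Rintegral_split (d := s) bq)// -[leRHS]add0r; apply: lerD.
  rewrite (_ : Rintegral _ _ _ = 0)//; transitivity (\int[mu]_(tau in `[0, s]) cst (0 : R) tau).
    apply: eq_Rintegral => tau; rewrite inE/= in_itv/= => /andP[tau0 taus].
    by rewrite /q !min_r ?subrr ?mul0r// (le_trans taus).
  by rewrite Rintegral_cst//= mul0r.
apply: le_Rintegral => //; try exact: bounded_measurable_integrable.
move=> tau; rewrite /= in_itv/= => /andP[stau tau1]; rewrite /q ler_wpM2r//.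
by rewrite (min_l stau) lerD2r ge_min lexx.
Qed.

Lemma response_clamp t : response b g t = response b g (clamp01 t).
Proof.
by rewrite /response; have [c0 c1] := clamp01_itv t; rewrite (clamp01_id c0 c1).
Qed.

Lemma response_le0 t : t <= 0 -> response b g t = 0.
Proof.
move=> t0; rewrite /response clamp01_le0// mulr0 add0r.
transitivity (\int[mu]_(tau in `[0, 1]) cst (0 : R) tau).
  apply: eq_Rintegral => tau; rewrite inE/= in_itv/= => /andP[tau0 _].
  by rewrite min_l// mul0r.
by rewrite Rintegral_cst//= mul0r.
Qed.

Lemma response1E : response b g 1 = b + \int[mu]_(s in `[0, 1]) (s * g s).
Proof.
rewrite /response clamp01_ge1// mulr1; congr (_ + _); apply: eq_Rintegral => s.
by rewrite inE/= in_itv/= => /andP[_ s1]; rewrite min_r.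
Qed.

Lemma response_homo : {homo response b g : s t / s <= t}.
Proof.
move=> s t st; rewrite (response_clamp s) (response_clamp t).
have [s0 _] := clamp01_itv s; have [t0 t1] := clamp01_itv t.
have /andP[cst _] := clamp01_increment st; rewrite subr_ge0 in cst.
have /andP[H _] := response_increment s0 cst t1; rewrite -subr_ge0.
apply: le_trans H; rewrite mulr_ge0 ?subr_ge0//.
by have /andP[] : 0 <= slope b g (clamp01 t) <= b + M by apply: slope_itv; rewrite in_itv/= t0.
Qed.

Lemma response_lipschitz : increments_le (b + M) (response b g).
Proof.
move=> s t st; rewrite (response_clamp s) (response_clamp t).
have [s0 s1] := clamp01_itv s; have [t0 t1] := clamp01_itv t.
have /andP[cst cst'] := clamp01_increment st; rewrite subr_ge0 in cst.
have /andP[_ H] := response_increment s0 cst t1; apply: le_trans H _.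
have /andP[H1 H2] : 0 <= slope b g (clamp01 s) <= b + M.
  by apply: slope_itv; rewrite in_itv/= s0.
by rewrite mulrC; apply: ler_pM; rewrite ?subr_ge0.
Qed.

Lemma has_deriv_itv_response t : t \in `[0, 1] ->
  has_deriv_itv 0 1 (response b g) t (slope b g t).
Proof.
move=> t01 e e0; have M1 : 0 < M + 1 by rewrite ltr_wpDl.
exists (e / (M + 1)); first by rewrite divr_gt0.
move=> s s01 st; have st' : M * `|s - t| <= e.
  apply: (@le_trans _ _ ((M + 1) * `|s - t|)).
    by rewrite ler_wpM2r// lerDl.
  by rewrite mulrC -ler_pdivlMr// ltW.
apply: (@le_trans _ _ (M * `|s - t| * `|s - t|)); last by rewrite ler_wpM2r.
have := slope_lipschitz t01 s01; move: s01 t01.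
rewrite !in_itv/= => /andP[s0 s1] /andP[t0 t1].
set x := slope b g s; set y := slope b g t.
have [ts|/ltW ts] := leP t s.
  have /andP[] := response_increment t0 ts s1; rewrite -/x -/y.
  rewrite (ger0_norm (_ : 0 <= s - t)) ?subr_ge0// => H1 H2.
  move=> sl; rewrite ler0_norm; last by rewrite subr_le0 mulrC.
  have {}sl : - (M * (s - t)) <= x - y by move: sl; rewrite ler_norml => /andP[].
  have := ler_wpM2r (_ : 0 <= s - t) sl; rewrite subr_ge0 => /(_ ts).
  by move: H1; lra.
have /andP[] := response_increment s0 ts t1; rewrite -/x -/y.
rewrite (ler0_norm (_ : s - t <= 0)) ?subr_le0// => H1 H2.
move=> sl; rewrite ler0_norm; last by move: H1; lra.
have {}sl : x - y <= M * - (s - t) by move: sl; rewrite ler_norml => /andP[].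
have := ler_wpM2r (_ : 0 <= t - s) sl; rewrite subr_ge0 => /(_ ts).
by move: H2; lra.
Qed.

(** Since [g] is only bounded and measurable, its primitive is differentiated at the Lebesgue points
    of [g]. *)
Lemma ae_has_deriv_itv_slope :
  {ae mu, forall t, t \in `[0, 1] -> has_deriv_itv 0 1 (slope b g) t (- g t)}.
Proof.
have lg : locally_integrable setT g.
  have -> : g = g \_ `[0, 1].
    by apply/funext => t; rewrite patchE mem_setE; case: ifPn => // /g_out.
  by apply: integrable_locally => //; exact: bounded_measurable_integrable.
have := lebesgue_differentiation lg.
apply: filterS; first exact: (ae_filter_ringOfSetsType mu).
move=> t lt; rewrite in_itv/= => /andP[t0 _].
have tt1 : t < t + 1 by rewrite ltrDl.
have [|d1 d2] := @FTC1_lebesgue_pt R g (BLeft (-1)) t (t + 1) tt1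
    (bounded_measurable_integrable _ _ bg) _ lt.
  by rewrite lte_fin (lt_le_trans _ t0)// ltrN10.
have : has_deriv_itv 0 1 (prim g) t (g t).
  by apply: is_derive_has_deriv_itv; split; [exact: d1|rewrite -derive1E d2].
move=> H e /H[d d0 {}H]; exists d => // s s01 /(H _ s01).
rewrite (_ : slope b g s - slope b g t - - g t * (s - t) =
  - (prim g s - prim g t - g t * (s - t))) ?normrN//.
by rewrite /slope; ring.
Qed.

End density.

(** Dominated convergence: on [[0, 1]] the kernel takes values in [[0, 1]], so the constant [M]
    dominates. *)
Lemma response_cvg (M : R) (b_ : nat -> R) (b : R) (g_ : nat -> R -> R) (g : R -> R) t :
  (forall k, measurable_fun setT (g_ k)) -> measurable_fun setT g ->
  (forall k s, 0 <= g_ k s <= M) ->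
  b_ k @[k --> \oo] --> b ->
  {ae mu, forall s, s \in `[0, 1] -> g_ k s @[k --> \oo] --> g s} ->
  response (b_ k) (g_ k) t @[k --> \oo] --> response b g t.
Proof.
move=> mg_ mg g_M bb gg; apply: cvgD.
  by apply: cvgM => //; exact: cvg_cst.
have [c0 c1] := clamp01_itv t.
have mmin : measurable_fun setT (fun s => Num.min (clamp01 t) s).
  by apply: measurable_minr => //; exact: measurable_cst.
have mE (f : R -> R) : measurable_fun setT f ->
    measurable_fun ([set` `[0, 1]] : set R) (EFin \o (fun s => Num.min (clamp01 t) s * f s)).
  by move=> mf; apply/measurable_EFinP; apply: measurable_funS (measurable_funM mmin mf).
have [|||ig _ cv] := @dominated_convergence _ _ R mu `[0, 1] (measurable_itv _)
  (fun k => EFin \o (fun s => Num.min (clamp01 t) s * g_ k s))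
  (EFin \o (fun s => Num.min (clamp01 t) s * g s)) (EFin \o cst M)
  (fun k => mE _ (mg_ k)) (mE _ mg).
- move: gg; apply: filterS; first exact: (ae_filter_ringOfSetsType mu).
  move=> s H s01; apply: cvg_EFin; first by apply: nearW.
  by apply: cvgM; [exact: cvg_cst|exact: H].
- by apply: bounded_measurable_integrable; split; [exact: measurable_cst|exists `|M|].
- apply: aeW => s k; rewrite /= in_itv/= => /andP[s0 s1].
  have /andP[g0 g1] := g_M k s; rewrite lee_fin normrM (ger0_norm g0) -[leRHS]mul1r.
  apply: ler_pM => //.
  by rewrite ger0_norm; [rewrite ge_min c1|rewrite le_min c0].
by apply: fine_cvg; rewrite fineK//; exact: integrable_fin_num.
Qed.

End response.

Lemma ae_le_Rintegral d (T : measurableType d) (R : realType)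
    (mu : {measure set T -> \bar R}) (D : set T) (f1 f2 : T -> R) : measurable D ->
  mu.-integrable D (EFin \o f1) -> mu.-integrable D (EFin \o f2) ->
  {ae mu, forall t, D t -> f1 t <= f2 t} ->
  \int[mu]_(t in D) f1 t <= \int[mu]_(t in D) f2 t.
Proof.
move=> mD i1 i2 f12; rewrite -subr_ge0 -RintegralB//.
have /integrableP[mB _] := integrableB mD i2 i1.
(* The difference equals its absolute value almost everywhere, so its integral is nonnegative. *)
rewrite /Rintegral (ae_eq_integral (fun t => `|(f2 t)%:E - (f1 t)%:E|%E))//.
- by apply: fine_ge0; exact: integral_ge0.
- exact: measurableT_comp.
- by apply: filterS f12 => t H Dt; rewrite /= ger0_norm// subr_ge0 H.
Qed.

(** * From a fixed profile to a solution, and the positive lower bound *)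

Section solution.
Context {R : realType}.
Local Notation mu := (@lebesgue_measure R).
Variables (r rho : R) (r_gt0 : 0 < r) (rho_gt0 : 0 < rho).
Implicit Types (psi : C2 (- r) 0) (w g : R -> R).

Lemma double_prim_boundary psi w : profile rho w ->
  Kpsi_boundary psi rho (psi_hat psi + double_prim r w).
Proof.
move=> pw; rewrite Kpsi_boundaryE//; exists (double_prim r w) => //; split.
  exact (K0_double_prim r_gt0 pw).
by rewrite (K0_normE r_gt0 (K0_double_prim r_gt0 pw)) (double_prim_norm r_gt0 rho_gt0 pw).
Qed.

Lemma abs_continuous_lipschitz (a b L : R) (f : R -> R) :
  (forall s t, s \in `[a, b] -> t \in `[a, b] -> `|f t - f s| <= L * `|t - s|) ->
  abs_continuous a b f.
Proof.
move=> fL e e0; have L0 : 0 < `|L| + 1 by rewrite ltr_wpDl.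
exists (e / (`|L| + 1)); first by rewrite divr_gt0.
move=> n x y xy _; rewrite ltr_pdivlMr// => H; apply: le_lt_trans H.
rewrite mulr_suml; apply: ler_sum => i _.
have [/andP[ax xyi] yb] := xy i.
have xab : x i \in `[a, b] by rewrite in_itv/= ax (le_trans xyi).
have yab : y i \in `[a, b] by rewrite in_itv/= yb (le_trans ax).
apply: le_trans (fL _ _ xab yab) _; rewrite ger0_norm ?subr_ge0// mulrC.
by rewrite ler_wpM2l ?subr_ge0// (le_trans (ler_norm _))// lerDl.
Qed.

(** On [[0, 1]] the extension [psi_hat] is quadratic, so it does not contribute to the third
    derivative. The fixed point equation [wE] replaces [w] by the response, whose derivative is
    [slope], itself differentiable almost everywhere with derivative [- g]. *)
Lemma response_solution psi (M b lambda : R) g w : 0 <= b ->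
  measurable_fun setT g -> (forall t, 0 <= g t <= M) ->
  (forall t, t \notin `[0, 1] -> g t = 0) ->
  profile rho w -> (forall t, w t = lambda * response b g t) ->
  let u := psi_hat psi + double_prim r w in
  [/\ is_Cn 3 0 1 u, abs_continuous 0 1 (derivn_itv 0 1 3 u),
    {ae mu, forall t, t \in `[0, 1] ->
       derivable_itv 0 1 (derivn_itv 0 1 3 u) t /\ derivn_itv 0 1 4 u t = - (lambda * g t)},
    (forall t, t \in `[- r, 0] -> u t = psi t) & derivn_itv 0 1 3 u 1 = lambda * b].
Proof.
move=> b0 mg gM g_out pw wE u.
have uE t : u t = psi_hat psi t + double_prim r w t.
  exact: (C2_derivnD (psi_hat psi) (double_prim r w) (i := 0) t isT).
have dprimE t : t \in `[- r, 1] -> double_prim r w t = prim (prim w) t.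
  by move=> tr; exact: (double_prim_derivn r_gt0 pw (i := 0) isT tr).
set q := derivn_itv (- r) 0 1 psi 0; set h := derivn_itv (- r) 0 2 psi 0.
have sub t : t \in `[0, 1] -> t \in `[- r, 1].
  by rewrite !in_itv/= => /andP[t0 ->]; rewrite andbT; move: r_gt0 t0; lra.
have u01 t : t \in `[0, 1] -> u t = psi 0 + t * q + t ^+ 2 / 2 * h + prim (prim w) t.
  move=> t01; rewrite uE (psi_hatE r_gt0)// ?sub// dprimE ?sub//.
  congr (_ + _); rewrite /psi_ext; case: ifPn => // t0.
  have -> : t = 0 by apply/le_anti; move: t01; rewrite in_itv/= t0 => /andP[->].
  by rewrite !mul0r expr0n/= !mul0r !addr0.
(* Explicit candidates for [u] and its first three derivatives; the passage from [w] to the response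
   takes place at index 2. *)
pose f i : R -> R := match i with
  | 0%N => u
  | 1%N => (fun t => q + t * h) \+ prim w
  | 2%N => fun t => h + lambda * response b g t
  | _ => fun t => lambda * slope b g t
  end.
have fE i : (i < 3)%N -> forall t, t \in `[0, 1] -> has_deriv_itv 0 1 (f i) t (f i.+1 t).
  case: i => [|[|[|//]]] _ t t01.
  - apply: (@has_deriv_itv_eq _ _ _
      ((fun t => psi 0 + t * q + t ^+ 2 / 2 * h) \+ prim (prim w))) => //.
      by move=> s s01; rewrite [RHS]u01.
    apply: has_deriv_itvD; first exact: has_deriv_itv_quadratic.
    exact: (has_deriv_itv_prim2 pw _ _ _).1.
  - rewrite [f 2%N t]/= -wE; apply: has_deriv_itvD; first exact: has_deriv_itv_affine.
    exact: (has_deriv_itv_prim2 pw _ _ _).2.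
  - move=> e e0; have H := has_deriv_itv_response b mg gM g_out t01.
    have [d d0 {}H] := has_deriv_itvZ lambda H e0; exists d => // s s01 /(H _ s01).
    by rewrite /= opprD addrACA subrr add0r.
have [E dE] := derivn_itv_chain ltr01 fE.
have E3 : {in `[0, 1], derivn_itv 0 1 3 u =1 fun t => lambda * slope b g t}.
  exact: (E 3%N).
have L : forall s t, s \in `[0, 1] -> t \in `[0, 1] ->
    `|derivn_itv 0 1 3 u t - derivn_itv 0 1 3 u s| <= (`|lambda| * M) * `|t - s|.
  move=> s t s01 t01; rewrite !E3// -mulrBr normrM -mulrA ler_wpM2l//.
  exact: slope_lipschitz.
split.
- split; first exact: dE.
  apply/within_itv_continuousP => t t01 e e0.
  have M1 : 0 < `|lambda| * M + 1.
    by have /andP[/le_trans H /H M0] := gM 0; rewrite ltr_wpDl// mulr_ge0.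
  exists (e / (`|lambda| * M + 1)); first by rewrite divr_gt0.
  move=> s s01; rewrite ltr_pdivlMr// => st; apply: le_trans (L _ _ t01 s01) _.
  by apply: le_trans (ltW st); rewrite mulrC ler_wpM2l// lerDl.
- exact: abs_continuous_lipschitz L.
- have := ae_has_deriv_itv_slope b mg gM g_out.
  apply: filterS; first exact: (ae_filter_ringOfSetsType mu).
  move=> t H t01.
  have {}H : has_deriv_itv 0 1 (derivn_itv 0 1 3 u) t (- (lambda * g t)).
    rewrite -mulrN; apply: has_deriv_itv_eq (has_deriv_itvZ lambda (H t01)) => //.
    by move=> s s01; rewrite E3.
  have dH := has_deriv_itvE ltr01 t01 H; split; last exact: dH.
  by apply/derivable_itvP => //; rewrite dH.
- move=> t tr; have t0 : t <= 0 by move: tr; rewrite in_itv/= => /andP[].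
  have tr1 : t \in `[- r, 1].
    by move: tr; rewrite !in_itv/= => /andP[-> _]; rewrite (le_trans t0).
  rewrite uE (psi_hatE r_gt0)// dprimE// /psi_ext t0 prim_le0 ?addr0//.
  by have [_] := iter_prim_regular pw 1; apply.
- have r1 : 1 \in `[0 : R, 1] by rewrite in_itv/= lexx ler01.
  by rewrite E3// /slope subrr addr0.
Qed.

(** Written with a positive part, the kernel is visibly measurable in [s] and nonnegative on the
    unit square. *)
Lemma kfunE (t s : R) : kfun t s = 6^-1 * (t ^+ 3 - Num.max (t - s) 0 ^+ 3).
Proof.
rewrite /kfun; case: (leP t s) => ts.
  by rewrite max_r ?subr_le0// expr0n/= subr0.
by rewrite max_l; [ring|rewrite subr_ge0 ltW].
Qed.

Lemma kfun_le (t s : R) : t \in `[0, 1] -> s \in `[0, 1] -> kfun t s <= s.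
Proof.
rewrite !in_itv/= => /andP[t0 t1] /andP[s0 s1]; rewrite /kfun.
have t2 : t ^+ 2 <= 1 by rewrite exprn_ile1.
rewrite ler_pdivrMl//; case: ifPn => ts.
  rewrite exprS; apply: le_trans (ler_wpM2l t0 t2) _; move: ts s0; lra.
rewrite -ltNge in ts; rewrite mulrC ler_wpM2r//.
have : s * s <= t * s by rewrite ler_wpM2r// ltW.
have : 0 <= t * s by rewrite mulr_ge0.
by rewrite [s ^+ 2]expr2 -[3 * t * s]mulrA; move: t2; lra.
Qed.

Lemma integrable_mul_continuous (k f : R -> R) : {within `[0, 1], continuous f} ->
  measurable_fun setT k -> (forall s, s \in `[0, 1] -> `|k s| <= 1) ->
  mu.-integrable `[0, 1] (EFin \o (fun s => k s * f s)).
Proof.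
move=> cf mk k1; have cnf : {within `[0, 1], continuous (fun s => `|f s|)}.
  by move=> x; apply: cvg_norm; exact: cf.
have [c c01 cmax] := EVT_max ler01 cnf.
apply: measurable_bounded_integrable => //.
- by rewrite [X in (X < _)%E](lebesgue_measure_itv `[0, 1])/=; case: ifP; rewrite ?ltry.
- apply: measurable_funM; first exact: measurable_funS mk.
  exact: subspace_continuous_measurable_fun.
- exists `|f c|; split; first exact: num_real.
  move=> x cx t t01 /=; apply: le_trans (ltW cx).
  rewrite normrM -[leRHS]mul1r.
  by apply: ler_pM => //; [exact: k1|exact: cmax].
Qed.

(** On the unit square [gamma3 t <= 1] and [kfun t s <= s], so every member of the set is at most
    the quantity in the conclusion. That quantity bounds from below the response at 1, where the
    kernel [min (1, s)] is [s]. *)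
Lemma source_gt0 (eta : R) (delta : R -> R) : 0 <= eta ->
  {within `[0, 1], continuous delta} -> (forall t, t \in `[0, 1] -> 0 <= delta t) ->
  0 < sup [set gamma3 t * eta + \int[mu]_(s in `[0, 1]) (kfun t s * delta s)
       | t in `[0, 1]] ->
  0 < eta + \int[mu]_(s in `[0, 1]) (s * delta s).
Proof.
move=> eta0 cdelta delta0 sup0; rewrite ltNge; apply/negP => le0.
move: sup0; rewrite ltNge => /negP; apply.
have ik := integrable_mul_continuous cdelta.
have mkfun (t : R) : measurable_fun setT (kfun t).
  rewrite (_ : kfun t = fun s => 6^-1 * (t ^+ 3 - Num.max (t - s) 0 ^+ 3)); last first.
    by apply/funext => s; exact: kfunE.
  apply: measurable_funM; first exact: measurable_cst.
  apply: measurable_funB; first exact: measurable_cst.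
  apply: measurable_funX; apply: measurable_maxr; last exact: measurable_cst.
  by apply: measurable_funB => //; exact: measurable_cst.
have kfun0 (t s : R) : t \in `[0, 1] -> s \in `[0, 1] -> 0 <= kfun t s.
  rewrite !in_itv/= => /andP[t0 t1] /andP[s0 s1]; rewrite kfunE mulr_ge0//.
  rewrite subr_ge0 lerXn2r ?nnegrE ?le_max ?lexx ?orbT//.
  by rewrite ge_max t0 gerBl s0.
rewrite -[leRHS](_ : sup [set (0 : R)] = 0); last exact: sup1.
rewrite sup1; apply: ge_sup; first by exists (gamma3 0 * eta +
    \int[mu]_(s in `[0, 1]) (kfun 0 s * delta s)), 0; rewrite //= in_itv/= lexx ler01.
move=> _ [t t01 <-]; apply: le_trans le0; apply: lerD.
  rewrite ler_piMl//; move: t01; rewrite /= in_itv/= => /andP[t0 t1].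
  by rewrite /gamma3 ler_pdivrMr// mul1r (le_trans (exprn_ile1 _ _ _))// ler1n.
apply: le_Rintegral => //.
- apply: ik => // s s01; rewrite ger0_norm ?kfun0//.
  by apply: le_trans (kfun_le t01 s01) _; move: s01; rewrite in_itv/= => /andP[].
- apply: ik => // s; rewrite in_itv/= => /andP[s0 s1]; first by rewrite ger0_norm.
- by move=> s s01; rewrite ler_wpM2r//; [exact: delta0|exact: kfun_le].
Qed.

End solution.

Theorem theorem3p2 (R : realType) (r : R) (r_gt0 : 0 < r)
  (psi : C2 (- r) 0)
  (psi_ge0 : forall t, t \in `[- r, 0] -> 0 <= psi t)
  (dpsi_ge0 : 0 <= derivn_itv (- r) 0 1 psi 0)
  (ddpsi_ge0 : 0 <= derivn_itv (- r) 0 2 psi 0)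
  (F : R -> C2 (- r) 0 -> R)
  (F_ge0 : forall t phi, t \in `[0, 1] -> 0 <= F t phi)
  (F_measurable : forall phi : C2 (- r) 0,
     lebesgue_measurable_fun `[0, 1] (fun t => F t phi))
  (F_continuous :
     {ae lebesgue_measure, forall t, t \in `[0, 1] -> continuous (F t)})
  (F_bounded : forall M : R, 0 < M ->
     exists2 phiM : R -> R, Linfty 0 1 phiM &
       forall phi : C2 (- r) 0, `|phi| <= M ->
         {ae lebesgue_measure, forall t, t \in `[0, 1] -> F t phi <= phiM t})
  (rho : R) (rho_gt0 : 0 < rho)
  (delta : R -> R)
  (delta_continuous : {within `[0, 1], continuous delta})
  (delta_ge0 : forall t, t \in `[0, 1] -> 0 <= delta t)
  (F_ge_delta : forall t (phi : C2 (- r) 0), t \in `[0, 1] ->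
     `|phi| <= rho + `|psi_hat psi| -> delta t <= F t phi)
  (B : C2 (- r) 1 -> R)
  (B_ge0 : forall u, Kpsi_closure psi rho u -> 0 <= B u)
  (B_continuous : {within Kpsi_closure psi rho, continuous B})
  (B_bounded : exists M, forall u, Kpsi_closure psi rho u -> B u <= M)
  (eta : R) (eta_ge0 : 0 <= eta)
  (B_ge_eta : forall u, Kpsi_boundary psi rho u -> eta <= B u)
  (sup_gt0 : 0 < sup [set gamma3 t * eta +
     \int[lebesgue_measure]_(s in `[0, 1]) (kfun t s * delta s)
       | t in `[0, 1]]) :
  exists lambda : R, 0 < lambda /\
    exists u : C2 (- r) 1, Kpsi_boundary psi rho u /\
      is_solution psi F B lambda u.
Proof.
pose mu := @lebesgue_measure R.
(* A common bound for the norms of all segments of all candidates; it is also the radius in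
   [F_ge_delta]. *)
pose K := rho + `|psi_hat psi|.
have K0 : 0 < K by rewrite ltr_wpDr.
have [phiK [_ [M0 phiK_le]] F_phiK] := F_bounded _ K0.
pose M := `|M0|.
have F_le v : `|v| <= K -> {ae mu, forall t, t \in `[0, 1] -> F t v <= M}.
  move=> vK; have FK := F_phiK _ vK.
  apply: (@filterS2 _ _ (ae_filter_ringOfSetsType mu) _ _ _ _ phiK_le FK).
  move=> t H1 H2 t01; apply: le_trans (H2 t01) _; apply: le_trans (ler_norm _) _.
  by apply: le_trans (H1 t01) _; exact: ler_norm.
pose u w := psi_hat psi + double_prim r w.
have u_boundary w : profile rho w -> Kpsi_boundary psi rho (u w).
  exact: double_prim_boundary.
have u_closure w : profile rho w -> Kpsi_closure psi rho (u w).
  by move=> /u_boundary[].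
have u_seg w t : profile rho w -> t \in `[0, 1] -> `|segment (u w) t| <= K.
  move=> pw t01; apply: le_trans (segment_norm r_gt0 _ t01) _.
  by apply: le_trans (ler_normD _ _) _; rewrite (double_prim_norm r_gt0 rho_gt0 pw) addrC.
(* A representative is chosen separately for each profile, with the value 0 for other functions. No
   regularity of the choice in [w] is needed, as [response] depends only on the class modulo null
   sets. *)
have /choice[G GP] : forall w, exists g : R -> R, profile rho w ->
    [/\ measurable_fun setT g, forall t, 0 <= g t <= M,
    forall t, t \notin `[0, 1] -> g t = 0 &
    {ae mu, forall t, t \in `[0, 1] -> g t = F t (segment (u w) t)}].
  move=> w; have [pw|npw] := pselect (profile rho w); last by exists (cst 0).
  have [||g gP] := @caratheodory_superposition R _ F K M F_ge0 F_measurable F_continuous F_le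
    (segment (u w)) (normr_ge0 _); last by exists g.
    move=> t t01 e e0; have [d d0 H] := segment_continuous r_gt0 (u w) e0.
    by exists d => // s s01; exact: H.
  by move=> t; exact: u_seg.
have [MB B_le] := B_bounded.
pose c := eta + \int[mu]_(s in `[0, 1]) (s * delta s).
have c_gt0 : 0 < c by exact: source_gt0.
pose H w := response (B (u w)) (G w).
have B0 w : profile rho w -> 0 <= B (u w) by move=> pw; exact/B_ge0/u_closure.
(* [u w] lies on the boundary, where [B] is at least [eta], and its segments lie in the ball where
   [F] is at least [delta]. *)
have H1_ge w : profile rho w -> c <= H w 1.
  move=> pw; have [mg gM gout gF] := GP w pw.
  rewrite /H response1E; apply: lerD; first exact/B_ge_eta/u_boundary.
  have id1 (s : R) : s \in `[0, 1] -> `|s| <= 1.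
    by rewrite in_itv/= => /andP[s0 s1]; rewrite ger0_norm.
  apply: ae_le_Rintegral => //.
  - exact: integrable_mul_continuous.
  - exact/bounded_measurable_integrable/(bounded_measurable_mul mg gM gout).
  - move: gF; apply: filterS; first exact: (ae_filter_ringOfSetsType mu).
    move=> t gt t01; rewrite gt//; apply: ler_wpM2l.
      by move: t01; rewrite /= in_itv/= => /andP[].
    by apply: F_ge_delta => //; exact: u_seg.
pose N w t := rho / H w 1 * H w t.
have H1_gt0 w : profile rho w -> 0 < H w 1.
  by move=> /H1_ge; exact: lt_le_trans.
(* The slope of [H w] is at most [MB + M], and the factor [rho / H w 1] is at most [rho / c]. *)
have N_profile w : profile rho w ->
    profile rho (N w) /\ increments_le (rho / c * (MB + M)) (N w).
  move=> pw; have [mg gM gout gF] := GP w pw.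
  have rH0 : 0 <= rho / H w 1 by rewrite divr_ge0 ?ltW// H1_gt0.
  have rHc : rho / H w 1 <= rho / c by rewrite ler_wpM2l ?lef_pV2 ?posrE ?H1_gt0 ?H1_ge// ltW.
  have hH := response_homo (B0 _ pw) mg gM gout.
  have NL : increments_le (rho / c * (MB + M)) (N w).
    move=> s t st; rewrite /N -mulrBr -mulrA; apply: ler_pM => //.
      by rewrite subr_ge0; exact: hH.
    apply: le_trans (response_lipschitz (B0 _ pw) mg gM gout st) _.
    by rewrite ler_wpM2r ?subr_ge0// lerD2r; exact/B_le/u_closure.
  have Nh : {homo N w : s t / s <= t}.
    by move=> s t st; rewrite /N ler_wpM2l//; exact: hH.
  split=> //; split=> [t t0|t t1|//|].
  - by rewrite /N /H (response_le0 _ _ t0) mulr0.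
  - rewrite /N /H (response_clamp _ _ t) clamp01_ge1// -/(H w 1) divfK//.
    by rewrite gt_eqF// H1_gt0.
  - exact: increments_le_continuous NL.
have H_cvg (v : nat -> R -> R) w : (forall k, profile rho (v k)) -> profile rho w ->
    (forall e : R, 0 < e -> \forall k \near \oo, forall t, `|v k t - w t| <= e) ->
    forall t, H (v k) t @[k --> \oo] --> H w t.
  move=> pv pw vw t.
  have uv e : 0 < e -> \forall k \near \oo, `|u w - u (v k)| <= e.
    move=> /vw; apply: filterS => k Hk; rewrite /u opprD addrACA subrr add0r.
    by apply: (double_prim_dist r_gt0 pw (pv k)) => s; rewrite distrC.
  have ucv : u (v k) @[k --> \oo] --> u w.
    by apply/cvgrPdist_le => e /uv.
  apply: (@response_cvg _ M).
  - by move=> k; have [] := GP _ (pv k).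
  - by have [] := GP _ pw.
  - by move=> k; have [_ + _ _] := GP _ (pv k).
  (* [B] is continuous only relative to the closure, in which all the [u (v k)] stay. *)
  - have /subspace_continuousP/(_ _ (u_closure _ pw)) := B_continuous.
    apply: (@cvg_comp _ _ _ (fun k => u (v k)) B _
      (within (Kpsi_closure psi rho) (nbhs (u w)))).
    move=> P /ucv H'; apply: (@filterS nat \oo _ _ (fun k => P (u (v k))) _ H').
    by move=> k; apply; exact (u_closure _ (pv k)).
  - have Gk : {ae mu, forall s k, s \in `[0, 1] -> G (v k) s = F s (segment (u (v k)) s)}.
      by apply: ae_foralln => k; have [] := GP _ (pv k).
    have [_ _ _ Gw] := GP _ pw.
    apply: (@filterS3 _ _ (ae_filter_ringOfSetsType mu) _ _ _ _ _ Gk Gw F_continuous).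
    move=> s Hk Hw Fc s01; rewrite Hw//.
    rewrite (_ : (fun k => _) = F s \o (fun k => segment (u (v k)) s)); last first.
      by apply/funext => k /=; rewrite Hk.
    apply: (@cvg_comp _ _ _ _ (F s) _ (nbhs (segment (u w) s))); last exact: Fc.
    apply/cvgrPdist_le => e /uv; apply: filterS => k.
    exact: le_trans (segment_dist r_gt0 _ _ s01).
have N_continuous (v : nat -> R -> R) w : (forall k, profile rho (v k)) -> profile rho w ->
    (forall e : R, 0 < e -> \forall k \near \oo, forall t, `|v k t - w t| <= e) ->
    forall t, N (v k) t @[k --> \oo] --> N w t.
  move=> pv pw vw t; apply: cvgM; last exact: H_cvg.
  apply: cvgM; first exact: cvg_cst.
  by apply: cvgV; [rewrite gt_eqF// H1_gt0|exact: H_cvg].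
have [w pw Nw] := monotone_fixed_point rho_gt0 N_profile N_continuous.
have [mg gM gout gF] := GP w pw.
(* The fixed point equation reads [w = lambda * H w] with [lambda = rho / H w 1]. *)
have [C3 AC sol upsi u3] := response_solution r_gt0 psi (B0 _ pw) mg gM gout pw
  (fun t => esym (Nw t)).
exists (rho / H w 1); split; first by rewrite divr_gt0 ?H1_gt0.
exists (u w); split; first exact: u_boundary.
split=> //.
apply: (@filterS2 _ _ (ae_filter_ringOfSetsType mu) _ _ _ _ sol gF).
move=> t H1 H2 t01; have [d1 d2] := H1 t01; split=> //.
by rewrite [X in X + _]d2 H2// addNr.
Qed.
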